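(* Let $d\ge 2$, let $H$ be a complex Hilbert space and let $A=(A_1,\dots,A_d):H\to H^d$, $Ah=(A_1h,\dots,A_dh)$, be a $d$-tuple of bounded linear operators on $H$ such that (i) $A_iA_j=A_jA_i$ for all $i,j=1,\dots,d$; (ii) $\Vert Ah\Vert_{H^d}\le \Vert h\Vert_H$ for all $h\in H$, i.e. $\sum_{j=1}^d\Vert A_jh\Vert_H^2\le\Vert h\Vert_H^2$. Let $X$ be the complement in $\mathbb{N}^d$ of the set $N:=\{n\in\mathbb{N}^d : A^n=0\}$, where $A^n=A_1^{n_1}\cdots A_d^{n_d}$. Then for every complex polynomial $Q$ in $d$ variables, $$\Vert Q(A)\Vert\le\Vert Q(B^X)\Vert\le \inf\{\Vert \varphi\Vert_{\mathcal{M}(H_d)} : \varphi\in\mathcal{M}(H_d),\ \varphi(M_z^X)=Q(M_z^X)\},$$ where $B^X$ is the compressed backward shift tuple on $\ell^2(X,\beta)$, $H_d$ is the Drury-Arveson space, and $M_z^X$ is the compressed $d$-shift on $H_d(X)$.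
   Context: $\mathbb{N}=\{0,1,2,\dots\}$; $e_1,\dots,e_d$ is the standard basis of $\mathbb{N}^d$. For a polynomial $Q(z)=\sum_k c_kz^k$ (finite sum over $k\in\mathbb{N}^d$) and a commuting $d$-tuple of bounded operators $A$, $Q(A)=\sum_k c_kA_1^{k_1}\cdots A_d^{k_d}$, with $A_j^0=I$. Norms of operators are operator norms. For $n\in\mathbb{N}^d$ put $|n|=n_1+\dots+n_d$, $n!=n_1!\cdots n_d!$, $\beta(n)=|n|!/n!$. The space $\ell^2(\mathbb{N}^d,\beta)$ consists of $g:\mathbb{N}^d\to\mathbb{C}$ with $\sum_n|g(n)|^2\beta(n)<\infty$ (with this as squared norm), and for $X\subseteq\mathbb{N}^d$, $\ell^2(X,\beta)$ is its closed subspace of functions supported in $X$. The backward shifts on $\ell^2(\mathbb{N}^d,\beta)$ are $B_jg(n)=g(n+e_j)$. $B^X=(B^X_1,\dots,B^X_d)$ where $B_j^X=P_XB_j|_{\ell^2(X,\beta)}$ and $P_X$ is the orthogonal projection of $\ell^2(\mathbb{N}^d,\beta)$ onto $\ell^2(X,\beta)$. The Drury-Arveson space $H_d$ is the Hilbert space of holomorphic functions $f(z)=\sum_{n\in\mathbb{N}^d}a(n)z^n$ on the unit ball $\mathbb{B}^d\subset\mathbb{C}^d$ with $\Vert f\Vert_{H_d}^2=\sum_n|a(n)|^2\beta(n)^{-1}<\infty$. $\mathcal{M}(H_d)$ is its multiplier algebra: the functions $\varphi$ on $\mathbb{B}^d$ such that $\varphi f\in H_d$ for all $f\in H_d$, with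 $\Vert\varphi\Vert_{\mathcal{M}(H_d)}=\Vert M_\varphi\Vert$, where $M_\varphi f=\varphi f$. $M_j$ denotes multiplication by the coordinate $z_j$, and $M_z=(M_1,\dots,M_d)$. For $X\subseteq\mathbb{N}^d$, $H_d(X)$ is the closed subspace of those $f\in H_d$ whose Taylor coefficients vanish on $\mathbb{N}^d\setminus X$; $P_X$ also denotes the orthogonal projection of $H_d$ onto $H_d(X)$, and $M_z^X=(M_1^X,\dots,M_d^X)$ with $M_j^X=P_XM_j|_{H_d(X)}$. For $\varphi\in\mathcal{M}(H_d)$, with $\varphi_r(z)=\varphi(rz)$, $\varphi(M_z)=\lim_{r\to1^-}\varphi_r(M_z)=M_\varphi$ in the strong operator topology, where $\varphi_r(M_z)$ is defined by the power series; correspondingly $\varphi(M_z^X)=\lim_{r\to1^-}\varphi_r(M_z^X)=P_XM_\varphi|_{H_d(X)}$. *)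

(* Defs.v *)
From HB Require Import structures.
From mathcomp Require Import all_boot all_order all_algebra.
From mathcomp Require Import sesquilinear complex.
(* the notations of mpoly clash with those of mathcomp-analysis *)
From mathcomp Require Import -(notations) mpoly.
From mathcomp Require Import all_classical all_reals all_analysis.
From mathcomp Require summability.

Set Implicit Arguments.
Unset Strict Implicit.
Unset Printing Implicit Defensive.

Import Order.TTheory GRing.Theory Num.Theory.
Import numFieldNormedType.Exports.

Local Open Scope classical_set_scope.
Local Open Scope ring_scope.
Local Open Scope complex_scope.

(* Conventions.  The complex numbers are R[i] for R : realType, written R[i]^o
   where their topology or module structure over themselves is needed.
   Multi-indices in N^d are the [multinom d] of the multinomials library.
   Norms take values in \bar R, with +oo for functions outside the space, so
   that no norm or operator norm has a junk finite value.  Operators on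
   function spaces are plain functions; only their values on the relevant
   subspace matter. *)

(* The norm of a normed R[i]-module is R[i]-valued; this is the same number
   as an element of R. *)
Definition rnorm (R : realType) (V : normedModType R[i]) (v : V) : R :=
  complex.Re `|v|.

(* sup of the norms of T v over v in D of norm at most 1, i.e. the operator
   norm of the restriction of T to the subspace D. *)
Definition opnorm (R : realType) (V : Type) (D : set V) (nrm : V -> \bar R)
    (T : V -> V) : \bar R :=
  ereal_sup [set nrm (T v) | v in [set v | D v /\ (nrm v <= 1)%E]].

(* T^n = T_1^(n_1) ... T_d^(n_d), the factors being composed in this order. *)
Definition opow (V : Type) (d : nat) (T : 'I_d -> V -> V) (n : multinom d) :
    V -> V :=
  \big[(fun f g : V -> V => f \o g)/idfun]_(j < d) iter (n j) (T j).

Definition poly_op (R : realType) (V : lmodType R[i]) (d : nat)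
    (T : 'I_d -> V -> V) (Q : mpoly d R[i]) (v : V) : V :=
  \sum_(k <- msupp Q) mcoeff k Q *: opow T k v.

Definition beta (R : realType) (d : nat) (n : multinom d) : R :=
  (mdeg n)`!%:R / (\prod_(j < d) (n j)`!)%:R.

Definition weighted_norm (R : realType) (d : nat) (w : multinom d -> R)
    (g : multinom d -> R[i]^o) : \bar R :=
  sqrte (\esum_(n in [set: multinom d]) (rnorm (g n) ^+ 2 * w n)%:E).

(* Multiplication by the indicator function of X.  It is the orthogonal
   projection of l^2(N^d, beta) onto l^2(X, beta): g - truncate X g vanishes on
   X, hence is orthogonal to every function supported in X. *)
Definition truncate (R : realType) (d : nat) (X : set (multinom d))
    (g : multinom d -> R[i]^o) : multinom d -> R[i]^o :=
  fun n => if `[< X n >] then g n else 0.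

Definition l2norm (R : realType) (d : nat) :
    (multinom d -> R[i]^o) -> \bar R :=
  weighted_norm (@beta R d).

Definition l2 (R : realType) (d : nat) (X : set (multinom d)) :
    set (multinom d -> R[i]^o) :=
  [set g | (l2norm g < +oo)%E /\ forall n, ~ X n -> g n = 0].

Definition backward_shift (R : realType) (d : nat) (j : 'I_d)
    (g : multinom d -> R[i]^o) : multinom d -> R[i]^o :=
  fun n => g (mnm_add n (mnm1 j)).

Definition compressed_backward_shift (R : realType) (d : nat)
    (X : set (multinom d)) (j : 'I_d) (g : multinom d -> R[i]^o) :
    multinom d -> R[i]^o :=
  truncate X (backward_shift j g).

(* The open unit ball of C^d, as a type: functions on the ball are functions
   out of this type. *)
Definition unit_ball (R : realType) (d : nat) : Type :=
  {z : 'rV[R[i]]_d | \sum_(j < d) `|z 0 j| ^+ 2 < 1}.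

Definition coordinate (R : realType) (d : nat) (j : 'I_d) :
    unit_ball R d -> R[i]^o :=
  fun z => sval z 0 j.

Definition monomial (R : realType) (d : nat) (n : multinom d) :
    unit_ball R d -> R[i]^o :=
  fun z => \prod_(j < d) coordinate j z ^+ n j.

(* f(z) = \sum_n a(n) z^n on the ball, as an unordered (absolutely convergent)
   sum.  A function on the ball is holomorphic iff it has such an expansion. *)
Definition taylor_expansion (R : realType) (d : nat)
    (f : unit_ball R d -> R[i]^o) (a : multinom d -> R[i]^o) : Prop :=
  forall z, summability.partial_sum (fun n => a n * monomial n z)
    @ summability.totally --> f z.

(* The expansion is unique when it exists. *)
Definition taylor (R : realType) (d : nat) (f : unit_ball R d -> R[i]^o) :
    multinom d -> R[i]^o :=
  xget (fun=> 0) [set a | taylor_expansion f a].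

Definition Hd_norm (R : realType) (d : nat) (f : unit_ball R d -> R[i]^o) :
    \bar R :=
  if `[< exists a, taylor_expansion f a >]
  then weighted_norm (fun n => (beta R n)^-1) (taylor f)
  else +oo%E.

(* H_d(X); in particular the Drury-Arveson space H_d itself is [Hd setT]. *)
Definition Hd (R : realType) (d : nat) (X : set (multinom d)) :
    set (unit_ball R d -> R[i]^o) :=
  [set f | (Hd_norm f < +oo)%E /\ forall n, ~ X n -> taylor f n = 0].

(* The orthogonal projection of H_d onto H_d(X): the monomials are orthogonal
   in H_d, so it drops the Taylor coefficients with index outside X. *)
Definition Hd_proj (R : realType) (d : nat) (X : set (multinom d))
    (f : unit_ball R d -> R[i]^o) : unit_ball R d -> R[i]^o :=
  fun z => summability.sum (fun n => truncate X (taylor f) n * monomial n z).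

Definition mult_op (R : realType) (d : nat) (phi : unit_ball R d -> R[i]^o)
    (f : unit_ball R d -> R[i]^o) : unit_ball R d -> R[i]^o :=
  fun z => phi z * f z.

Definition multiplier (R : realType) (d : nat) :
    set (unit_ball R d -> R[i]^o) :=
  [set phi | forall f, Hd setT f -> Hd setT (mult_op phi f)].

Definition multiplier_norm (R : realType) (d : nat)
    (phi : unit_ball R d -> R[i]^o) : \bar R :=
  opnorm (Hd setT) (@Hd_norm R d) (mult_op phi).

Definition compressed_shift (R : realType) (d : nat) (X : set (multinom d))
    (j : 'I_d) (f : unit_ball R d -> R[i]^o) : unit_ball R d -> R[i]^o :=
  Hd_proj X (mult_op (coordinate j) f).

(* S = \sum_n c(n) (M_z^X)^n, as an unordered sum of operators on H_d(X)
   converging in operator norm. *)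
Definition compressed_shift_series (R : realType) (d : nat)
    (X : set (multinom d)) (c : multinom d -> R[i])
    (S : (unit_ball R d -> R[i]^o) -> unit_ball R d -> R[i]^o) : Prop :=
  (fun J => opnorm (Hd X) (@Hd_norm R d) (fun f =>
     summability.partial_sum
       (fun n => c n *: opow (compressed_shift X) n f) J - S f))
    @ summability.totally --> 0%E.

(* phi(M_z^X) = S: the operators Sr r = phi_r(M_z^X), where
   phi_r(z) = phi(r z) has Taylor coefficients taylor phi n * r ^ |n|, converge
   to S on H_d(X) in the strong operator topology as r -> 1^-. *)
Definition compressed_calculus (R : realType) (d : nat)
    (X : set (multinom d)) (phi : unit_ball R d -> R[i]^o)
    (S : (unit_ball R d -> R[i]^o) -> unit_ball R d -> R[i]^o) : Prop :=
  exists Sr : R -> (unit_ball R d -> R[i]^o) -> unit_ball R d -> R[i]^o,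
    (forall r, 0 <= r < 1 ->
       compressed_shift_series X (fun n => taylor phi n * (r ^+ mdeg n)%:C)
         (Sr r)) /\
    (forall f, Hd X f -> Hd_norm (Sr r f - S f) @[r --> 1^'-] --> 0%E).

(* Main.v *)
Require Import Defs.
From HB Require Import structures.
From mathcomp Require Import all_boot all_order all_algebra.
From mathcomp Require Import sesquilinear complex.
From mathcomp Require Import -(notations) mpoly.
From mathcomp Require Import all_classical all_reals all_analysis.
From mathcomp Require Import finmap ring zify.
From mathcomp Require summability.

(* First inequality.  For T = r A with r < 1 the positive form
   q(x) = |x|^2 - sum_j |T_j x|^2 satisfies, by the Pascal recursion for beta,
   sum_(|n| < M) beta(n) q(T^n x) = |x|^2 - O(r^(2M)).  Diagonalising the Gram
   matrix of q on the vectors T^n h of bounded degree turns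
   n |-> (T^n h) into finitely many scalar functions supported in X, on which
   Q(T) acts as Q(B^X); hence |Q(T) h| <= |Q(B^X)| |h|, and then r -> 1.

   Second inequality.  Applied to the constant 1, phi(M_z^X) = Q(M_z^X) says
   that phi and Q have the same coefficients on X (X is closed under taking
   divisors).  Hence, in the bilinear duality between l^2(beta) and
   l^2(1/beta), <Q(B^X) g, f> = <g, phi f> for g in l^2(X, beta) and f a
   polynomial, which is at most |g| |phi f| <= |g| |phi| |f|. *)

Import Order.TTheory GRing.Theory Num.Theory.
Import numFieldNormedType.Exports.

Local Open Scope classical_set_scope.
Local Open Scope ring_scope.
Local Open Scope complex_scope.

Set Implicit Arguments.
Unset Strict Implicit.
Unset Printing Implicit Defensive.

(* The factor r < 1 is there to kill the remainder of the telescoped sum. For [A] itself the level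
   sums of beta(n) |A^n x|^2 over |n| = M decrease in M but may keep a positive limit, and then q no
   longer recovers |x|^2. The remainder has to vanish only at x = Q(T)h, where |x|^2 is bounded from
   above; at x = h its sign suffices. The natural argument would let Q(B^X) act on H-valued
   functions. The Gram diagonalisation replaces these by finitely many scalar functions, to each of
   which the norm of Q(B^X) applies separately. Finite families are enough because the sum over
   degrees below M involves T^n h only for finitely many n; support in X comes from T^n h = 0 off X.
   In the second inequality the obstacle is that elements of H_d are functions on the ball: reading
   off a coefficient requires uniqueness of unordered power series expansions, which is obtained by
   restriction to curves in the ball. *)
Existing Instance summability.totally_filter.

(** * Operator monomials and multinomial weights *)

(** One computation for four orbits: the powers of a commuting tuple, the translates of a function
    supported in [X], the rescaled powers of [A], and the monomials cut down to [X]. *)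
Lemma opow_translate (V : Type) (d : nat) (T : 'I_d -> V -> V)
    (u : multinom d -> V) :
    (forall j n, T j (u n) = u (mnm_add n (mnm1 j))) ->
  forall n m, opow T n (u m) = u (mnm_add m n).
Proof.
move=> uT n m; rewrite /opow.
have itE j k p : iter k (T j) (u p) = u (mnm_add p (mnm_muln (mnm1 j) k)).
  elim: k => [|k IH]; first by rewrite mulm0n addm0.
  by rewrite iterS IH uT -addmA mulmSr.
rewrite [in RHS](multinomUE_id n).
elim: (index_enum _) => [|j r IH]; first by rewrite !big_nil addm0.
by rewrite !big_cons /= IH itE -addmA [X in mnm_add m X]addmC.
Qed.

Section CommutingPowers.
Variables (V : Type) (d : nat) (T : 'I_d -> V -> V).
Hypothesis Tcomm : forall i j x, T i (T j x) = T j (T i x).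

Lemma opowS n j x : T j (opow T n x) = opow T (mnm_add n (mnm1 j)) x.
Proof.
have itC i k y : T j (iter k (T i) y) = iter k (T i) (T j y).
  by elim: k => //= k IH; rewrite Tcomm IH.
rewrite /opow.
(* Generalised to partial products: the extra factor [T j] has appeared exactly when [j] belongs to
   the duplicate-free list [r]. *)
have : forall r : seq 'I_d, uniq r ->
   (\big[(fun f g : V -> V => f \o g)/idfun]_(i <- r)
       iter (mnm_add n (mnm1 j) i) (T i)) x =
   (if j \in r then T j else id)
     ((\big[(fun f g : V -> V => f \o g)/idfun]_(i <- r) iter (n i) (T i)) x).
  elim=> [|i r IH] /=; first by rewrite !big_nil.
  move=> /andP[ir /IH {}IH]; rewrite !big_cons /= {}IH inE mnmDE mnm1E.
  have [->|ji] := eqVneq j i; first by rewrite (negPf ir) addn1 iterS.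
  by rewrite addn0 /=; case: ifP => //; rewrite itC.
by move/(_ _ (index_enum_uniq _)) ->; rewrite mem_index_enum.
Qed.

Lemma opow0 x : opow T (mnm0 : multinom d) x = x.
Proof.
rewrite /opow; elim: (index_enum _) => [|i r IH]; first by rewrite big_nil.
by rewrite big_cons /= IH mnm0E.
Qed.

Lemma opowD n m x : opow T n (opow T m x) = opow T (mnm_add m n) x.
Proof.
by apply: (@opow_translate _ _ T (fun k => opow T k x)) => j k; rewrite opowS.
Qed.

End CommutingPowers.

Section Beta.
Variables (R : realType) (d : nat).
Implicit Types n m : multinom d.

Lemma beta_gt0 n : 0 < beta R n.
Proof.
rewrite /beta divr_gt0 // ltr0n ?fact_gt0 //.
by rewrite prodn_gt0 // => i; rewrite fact_gt0.
Qed.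

Lemma beta0 : beta R (mnm0 : multinom d) = 1.
Proof.
rewrite /beta mdeg0 big1 ?divr1 // => i _.
by rewrite mnm0E.
Qed.

Lemma mdeg_mnmB1 m j : m j != 0%N -> (mdeg (mnm_sub m (mnm1 j))).+1 = mdeg m.
Proof.
move=> mj; have /submK {2}<- : mpoly.lem (mnm1 j) m by rewrite lep1mP.
by rewrite mdegD mdeg1 addn1.
Qed.

Lemma beta_pred m j : m j != 0%N ->
  (mdeg m)%:R * beta R (mnm_sub m (mnm1 j)) = (m j)%:R * beta R m.
Proof.
move=> mj; rewrite /beta -(mdeg_mnmB1 mj) factS.
have -> : (\prod_(i < d) (m i)`! =
    m j * \prod_(i < d) (mnm_sub m (mnm1 j) i)`!)%N.
  rewrite (bigD1 j) //= [in RHS](bigD1 j) //= mulnA; congr (_ * _)%N.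
    by rewrite mnmBE mnm1E eqxx; case: (m j) mj => // k _; rewrite subn1 factS.
  apply: eq_bigr => i ij; rewrite mnmBE mnm1E eq_sym (negPf ij) subn0 //.
set a := (_`!)%N; set b := (\prod_(i < d) _)%N.
have b0 : b%:R != 0 :> R.
  by rewrite pnatr_eq0 -lt0n prodn_gt0 // => i; rewrite fact_gt0.
have mj0 : (m j)%:R != 0 :> R by rewrite pnatr_eq0.
by rewrite !natrM; field; rewrite b0 mj0.
Qed.

(** [beta R m] counts the words with letter multiplicities [m], and the sum sorts them by their last
    letter. The computation multiplies by [mdeg m], the sum of the [m j]. *)
Lemma beta_rec m : m != mnm0 ->
  \sum_(j < d | m j != 0%N) beta R (mnm_sub m (mnm1 j)) = beta R m.
Proof.
move=> m0; have dm : (mdeg m)%:R != 0 :> R by rewrite pnatr_eq0 mdeg_eq0.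
apply: (mulfI dm); rewrite mulr_sumr.
under eq_bigr => j mj do rewrite beta_pred //.
rewrite -mulr_suml; congr (_ * _); rewrite mdegE natr_sum.
rewrite [RHS](bigID (fun j => m j != 0%N)) /= [X in _ + X]big1 ?addr0 //.
by move=> j /negPn /eqP ->.
Qed.

End Beta.

(** * Gram decomposition of positive forms *)

Section Gram.
Local Open Scope sesquilinear_scope.
Variables (C : numClosedFieldType) (V : lmodType C) (B : V -> V -> C).
Hypothesis Bl : forall a x y z, B (a *: x + y) z = a * B x z + B y z.
Hypothesis Bherm : forall x y, B y x = (B x y)^*%R.
Hypothesis B_ge0 : forall x, 0 <= B x x.

Lemma form_suml n (c : 'I_n -> C) (v : 'I_n -> V) z :
  B (\sum_i c i *: v i) z = \sum_i c i * B (v i) z.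
Proof.
have B0 : B 0 z = 0.
  by have := Bl (-1) 0 0 z; rewrite scaler0 add0r mulN1r addNr.
elim: n c v => [|n IH] c v; first by rewrite !big_ord0.
by rewrite !big_ord_recl Bl IH.
Qed.

(** Unitary diagonalisation of the Gram matrix of [v]. Linear dependence among the [v x] only
    produces zero eigenvalues. *)
Lemma gram_ord n (v : 'I_n -> V) :
  exists (D : 'I_n -> C) (P : 'I_n -> 'I_n -> C), (forall i, 0 <= D i) /\
    forall c : 'I_n -> C, B (\sum_x c x *: v x) (\sum_x c x *: v x) =
      \sum_i D i * `|\sum_x c x * P i x| ^+ 2.
Proof.
pose G : 'M[C]_n := \matrix_(x, y) B (v x) (v y).
have formE (c : 'rV[C]_n) : B (\sum_x c 0 x *: v x) (\sum_x c 0 x *: v x) =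
    (c *m G *m c^t*) 0 0.
  rewrite form_suml -mulmxA mxE; apply: eq_bigr => x _; congr (_ * _).
  rewrite Bherm form_suml rmorph_sum mxE; apply: eq_bigr => y _.
  by rewrite !mxE rmorphM /= -Bherm mulrC.
have Gherm : G \is hermsymmx.
  apply/is_hermitianmxP; rewrite expr0 scale1r.
  by apply/matrixP => x y; rewrite !mxE Bherm.
have /orthomx_spectralP := hermitian_normalmx Gherm.
set P := spectralmx G; set D := spectral_diag G => GE.
have Pu : P \is unitarymx by exact: spectral_unitarymx.
rewrite invmx_unitary // in GE.
have diagE (w : 'rV[C]_n) : (w *m diag_mx D *m w^t*) 0 0 =
    \sum_i D 0 i * `|w 0 i| ^+ 2.
  rewrite mxE; apply: eq_bigr => i _.
  rewrite mul_mx_diag !mxE normCK; ring.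
exists (fun i => D 0 i), (fun i x => (P i x)^*%R); split.
  (* [c] is the [i]-th row of [P], an eigenvector, so the form takes the single value [D 0 i] at
     it. *)
  move=> i; pose c : 'rV[C]_n := delta_mx 0 i *m P.
  have := B_ge0 (\sum_x c 0 x *: v x).
  rewrite formE GE !mulmxA -(mulmxA _ _ (c^t*)).
  have -> : c *m P^t* = delta_mx 0 i by rewrite /c mulmxtVK.
  have -> : P *m c^t* = (delta_mx 0 i)^t*.
    by rewrite /c trmx_mul map_mxM mulmxA (unitarymxP Pu) mul1mx.
  rewrite diagE (bigD1 i) //= big1 ?addr0.
    by rewrite mxE !eqxx normr1 expr1n mulr1.
  by move=> j ji; rewrite mxE (negPf ji) andbF normr0 expr0n mulr0.
move=> c; pose w := (\row_x c x) : 'rV[C]_n.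
have -> : \sum_x c x *: v x = \sum_x w 0 x *: v x.
  by apply: eq_bigr => x _; rewrite mxE.
rewrite formE GE !mulmxA -(mulmxA _ _ (w^t*)).
have -> : P *m w^t* = (w *m P^t*)^t* by rewrite trmx_mul map_mxM trmxCK.
rewrite diagE; apply: eq_bigr => i _; congr (_ * `|_| ^+ 2).
by rewrite mxE; apply: eq_bigr => x _; rewrite !mxE.
Qed.

Lemma gram (I : finType) (v : I -> V) :
  exists n (D : 'I_n -> C) (P : 'I_n -> I -> C), (forall i, 0 <= D i) /\
    forall c : I -> C, B (\sum_x c x *: v x) (\sum_x c x *: v x) =
      \sum_i D i * `|\sum_x c x * P i x| ^+ 2.
Proof.
have [D [P [D0 PE]]] := gram_ord (fun i : 'I_#|I| => v (enum_val i)).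
exists #|I|, D, (fun i x => P i (enum_rank x)); split=> // c.
have sE (W : nmodType) (F : I -> W) :
    \sum_x F x = \sum_(i < #|I|) F (enum_val i).
  rewrite (reindex (fun i : 'I_#|I| => enum_val i)) //; apply: onW_bij.
  exact: enum_val_bij.
rewrite sE PE; apply: eq_bigr => i _; congr (_ * `|_| ^+ 2).
by rewrite sE; apply: eq_bigr => x _; rewrite enum_valK.
Qed.

End Gram.

Section Rnorm.
Variable (R : realType).

Lemma rnormE (V : normedModType R[i]) (v : V) : (rnorm v)%:C = `|v|.
Proof. by rewrite /rnorm RRe_real // ger0_real. Qed.

Lemma rnorm_ge0 (V : normedModType R[i]) (v : V) : 0 <= rnorm v.
Proof. by rewrite -ler0c rnormE. Qed.

Lemma rnormZ (V : normedModType R[i]) (a : R[i]^o) (v : V) :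
  rnorm (a *: v) = rnorm a * rnorm v.
Proof. by apply: complexI; rewrite rmorphM /= !rnormE normrZ. Qed.

Lemma rnormD (V : normedModType R[i]) (v w : V) :
  rnorm (v + w) <= rnorm v + rnorm w.
Proof. by rewrite -lecR rmorphD /= !rnormE ler_normD. Qed.

Lemma rnorm_real (x : R) : 0 <= x -> rnorm (x%:C : R[i]^o) = x.
Proof. by move=> x0; apply: complexI; rewrite rnormE ger0_norm // ler0c. Qed.

Lemma rnormM (a b : R[i]^o) : rnorm (a * b : R[i]^o) = rnorm a * rnorm b.
Proof. exact: rnormZ. Qed.

End Rnorm.

(** The index map [e] will be the translation by a fixed [n], so that one choice of functions [g i]
    serves all the vectors T^n Q(T) h at once. *)
Lemma gram_finsupp (C : numClosedFieldType) (V : lmodType C) (B : V -> V -> C)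
    (Bl : forall a x y z, B (a *: x + y) z = a * B x z + B y z)
    (Bherm : forall x y, B y x = (B x y)^*%R) (B_ge0 : forall x, 0 <= B x x)
    (S : choiceType) (W : S -> V) (s : seq S) :
    (forall n, n \notin s -> W n = 0) ->
  exists p (D : 'I_p -> C) (g : 'I_p -> S -> C),
    [/\ forall i, 0 <= D i, forall i n, W n = 0 -> g i n = 0 &
    forall (r : seq S) (a : S -> C) (e : S -> S),
      B (\sum_(k <- r) a k *: W (e k)) (\sum_(k <- r) a k *: W (e k)) =
      \sum_i D i * `|\sum_(k <- r) a k * g i (e k)| ^+ 2].
Proof.
move=> Ws.
have [p [D [P [D0 PE]]]] := gram Bl Bherm B_ge0 (fun x : seq_sub s => W (val x)).
(* The factor [W n != 0] forces [g i n = 0] wherever [W n = 0]; an eigenvector for the eigenvalue 0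
   need not vanish there by itself. *)
pose dl n (x : seq_sub s) : C := ((val x == n) && (W n != 0))%:R.
have WE n : W n = \sum_x dl n x *: W (val x).
  have [W0|Wn0] := eqVneq (W n) 0.
    by rewrite big1 // => x _; rewrite /dl W0 eqxx andbF scale0r.
  have ns : n \in s by apply: contraNT Wn0 => /Ws ->.
  rewrite (bigD1 (SeqSub ns)) //= big1 ?addr0 /dl /=.
    by rewrite eqxx Wn0 scale1r.
  move=> x xn; have -> : (ssval x == n) = false.
    by apply/negP => /eqP xE; move/eqP: xn; apply; apply: val_inj.
  by rewrite scale0r.
exists p, D, (fun i n => \sum_x dl n x * P i x); split=> //.
  by move=> i n W0; rewrite big1 // => x _; rewrite /dl W0 eqxx andbF mul0r.
move=> r a e; pose c x := \sum_(k <- r) a k * dl (e k) x.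
have -> : \sum_(k <- r) a k *: W (e k) = \sum_x c x *: W (val x).
  rewrite /c; under [RHS]eq_bigr => x _ do rewrite scaler_suml.
  rewrite exchange_big /=; apply: eq_bigr => k _.
  by rewrite {1}WE scaler_sumr; apply: eq_bigr => x _; rewrite scalerA.
rewrite PE; apply: eq_bigr => i _; congr (_ * `|_| ^+ 2).
rewrite /c; under eq_bigr => x _ do rewrite mulr_suml.
rewrite exchange_big /=; apply: eq_bigr => k _.
by rewrite mulr_sumr; apply: eq_bigr => x _; rewrite mulrA.
Qed.

(** * The von Neumann inequality *)

Section Mons.
Variables (R : realType) (d : nat).
Implicit Types n m : multinom d.

Definition mons N : seq (multinom d) := map (@bmnm d N) (enum {: bmultinom d N}).

Lemma mons_uniq N : uniq (mons N).
Proof. by rewrite map_inj_uniq ?enum_uniq //; exact: val_inj. Qed.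

Lemma mem_mons N n : (n \in mons N) = (mdeg n < N)%N.
Proof.
apply/mapP/idP => [[x _ ->]|nN]; first exact: bmdeg.
by exists (BMultinom nN); rewrite ?mem_enum.
Qed.

Lemma mons_pred1 (F : multinom d -> R) N :
  \sum_(n <- mons N.+1 | mdeg n == 0%N) F n = F mnm0.
Proof.
rewrite big_mkcond (bigD1_seq mnm0) ?mons_uniq ?mem_mons ?mdeg0 //=.
by rewrite big1 ?addr0 // => n; rewrite mdeg_eq0 => /negPf ->.
Qed.

Lemma sum_mons_le (F : multinom d -> R) M N : (M <= N)%N ->
  \sum_(n <- mons M) F n = \sum_(n <- mons N | (mdeg n < M)%N) F n.
Proof.
move=> MN; rewrite -[RHS]big_filter; apply: perm_big; apply: uniq_perm.
- exact: mons_uniq.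
- by rewrite filter_uniq ?mons_uniq.
- by move=> n; rewrite mem_filter !mem_mons; case: ltnP => //= /leq_trans ->.
Qed.

Lemma reindex_mons (F : multinom d -> R) j k N : (k.+1 < N)%N ->
  \sum_(m <- mons N | (mdeg m == k.+1) && (m j != 0%N)) F m =
  \sum_(n <- mons N | mdeg n == k) F (mnm_add n (mnm1 j)).
Proof.
move=> kN; rewrite -[LHS]big_filter -[RHS]big_filter.
rewrite -(big_map (fun n => mnm_add n (mnm1 j)) predT F).
apply: perm_big; apply: uniq_perm.
- by rewrite filter_uniq ?mons_uniq.
- rewrite map_inj_uniq ?filter_uniq ?mons_uniq //; exact: addIm.
- move=> m; rewrite mem_filter mem_mons; apply/idP/mapP.
    move=> /andP[/andP[/eqP mk mj] mN].
    exists (mnm_sub m (mnm1 j)); last by rewrite submK // lep1mP.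
    have := mdeg_mnmB1 mj; rewrite mem_filter mem_mons; lia.
  move=> [n]; rewrite mem_filter mem_mons => /andP[/eqP nk nN] ->.
  by rewrite mdegD mdeg1 addn1 nk eqxx kN mnmDE mnm1E eqxx addn1.
Qed.

(** Substituting m = n + e_j collects at [m] the weights [beta R (m - e_j)], which add up to
    [beta R m] by [beta_rec]. *)
Lemma beta_sum_step (F : multinom d -> R) k N : (k.+1 < N)%N ->
  \sum_(m <- mons N | mdeg m == k.+1) beta R m * F m =
  \sum_(n <- mons N | mdeg n == k)
     beta R n * \sum_(j < d) F (mnm_add n (mnm1 j)).
Proof.
move=> kN; under [RHS]eq_bigr => n _ do rewrite mulr_sumr.
rewrite exchange_big /=.
under [RHS]eq_bigr => j _.
  rewrite (eq_bigr (fun n => beta R (mnm_sub (mnm_add n (mnm1 j)) (mnm1 j)) *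
    F (mnm_add n (mnm1 j)))); last by move=> n _; rewrite addmK.
  rewrite -(reindex_mons (fun m => beta R (mnm_sub m (mnm1 j)) * F m)) //.
  rewrite big_mkcondr /=; over.
rewrite exchange_big /=; apply: eq_bigr => m /eqP mk.
rewrite -big_mkcond -mulr_suml beta_rec // -mdeg_eq0 mk //.
Qed.

(** By [beta_sum_step], what level k subtracts is exactly the sum over level k + 1, so only the two
    end levels survive. *)
Lemma beta_telescope (F : multinom d -> R) M :
  \sum_(n <- mons M)
     beta R n * (F n - \sum_(j < d) F (mnm_add n (mnm1 j))) =
  F mnm0 - \sum_(n <- mons M.+1 | mdeg n == M) beta R n * F n.
Proof.
(* One list [mons N] is kept throughout and filtered by degree, so that only the cutoff [m] moves in
   the induction. *)
suff H (N m : nat) : (m < N)%N -> \sum_(n <- mons N | (mdeg n < m)%N)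
     beta R n * (F n - \sum_(j < d) F (mnm_add n (mnm1 j))) =
  F mnm0 - \sum_(n <- mons N | mdeg n == m) beta R n * F n.
  by rewrite (sum_mons_le _ (leqnSn M)) H.
elim: m => [|m IH] mN.
  case: N mN => // N _; rewrite mons_pred1 beta0 mul1r subrr.
  by rewrite big_pred0.
rewrite (bigID (fun n => mdeg n == m)) /= beta_sum_step //.
rewrite (eq_bigl (fun n => mdeg n == m)); last first.
  by move=> n; rewrite ltnS; case: eqP => [->|]; rewrite ?leqnn ?andbF.
rewrite [X in _ + X](eq_bigl (fun n => (mdeg n < m)%N)); last first.
  by move=> n; rewrite ltnS andbC ltn_neqAle.
rewrite IH; last exact: ltnW.
under eq_bigr => n _ do rewrite mulrBr.
rewrite sumrB; ring.
Qed.

End Mons.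

(** * The estimate for a strictly contractive commuting tuple *)

Section FiniteVonNeumann.
Variables (R : realType) (d : nat) (H : normedModType R[i]).
Variable ip : {dot H for Num.conj}.
Hypothesis norm_ip : forall h : H, `|h| ^+ 2 = ip h h.
Variable T : 'I_d -> {linear H -> H}.
Hypothesis Tcomm : forall i j h, T i (T j h) = T j (T i h).
Variable rho : R.
Hypotheses (rho_ge0 : 0 <= rho) (rho_lt1 : rho < 1).
Hypothesis Tcontr : forall h,
  \sum_(j < d) rnorm (T j h) ^+ 2 <= rho * rnorm h ^+ 2.

Let pw n h : H := opow (fun j => T j) n h.

(** The form of the defect operator I - sum_j T_j^* T_j, written without adjoints. *)
Let defect x y : R[i] := ip x y - \sum_(j < d) ip (T j x) (T j y).

Lemma rnorm_ip h : (rnorm h ^+ 2)%:C = ip h h.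
Proof. by rewrite -norm_ip -rnormE rmorphXn. Qed.

Lemma defectE h :
  defect h h = (rnorm h ^+ 2 - \sum_(j < d) rnorm (T j h) ^+ 2)%:C.
Proof.
rewrite rmorphB rmorph_sum /= rnorm_ip; congr (_ - _).
by apply: eq_bigr => j _; rewrite rnorm_ip.
Qed.

Lemma defectl a x y z : defect (a *: x + y) z = a * defect x z + defect y z.
Proof.
rewrite /defect linearPl /= mulrBr mulr_sumr.
under eq_bigr => j _ do rewrite linearP linearPl /=.
rewrite big_split /=; ring.
Qed.

Lemma defect_herm x y : defect y x = (defect x y)^*%R.
Proof.
have ipC u v : ip u v = (ip v u)^*%R by rewrite hermC expr0 mul1r.
rewrite /defect rmorphB rmorph_sum /= -ipC; congr (_ - _).
by apply: eq_bigr => j _; rewrite -ipC.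
Qed.

Lemma defect_ge0 x : 0 <= defect x x.
Proof.
rewrite defectE ler0c subr_ge0 (le_trans (Tcontr x)) //.
by rewrite ler_piMl ?sqr_ge0 // ltW.
Qed.

(** By [beta_sum_step] the sum over level m + 1 is a [beta]-weighted sum over level m of the
    quantities bounded in [Tcontr], so each level costs a factor [rho]. *)
Lemma level_decay x m N : (m < N)%N ->
  \sum_(n <- mons d N | mdeg n == m) beta R n * rnorm (pw n x) ^+ 2 <=
  rho ^+ m * rnorm x ^+ 2.
Proof.
elim: m => [|m IH] mN.
  case: N mN => // N _; rewrite mons_pred1 beta0 !mul1r.
  by rewrite /pw opow0.
rewrite (beta_sum_step (fun n => rnorm (pw n x) ^+ 2)) //.
rewrite exprS -mulrA; apply: (@le_trans _ _ (rho *
  (\sum_(n <- mons d N | mdeg n == m) beta R n * rnorm (pw n x) ^+ 2))).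
  rewrite mulr_sumr; apply: ler_sum => n _.
  rewrite mulrCA ler_wpM2l ?(ltW (beta_gt0 _ _)) //.
  under eq_bigr => j _ do rewrite /pw -opowS //.
  exact: Tcontr.
by rewrite ler_wpM2l // IH // ltnW.
Qed.

Lemma defect_telescope x M :
  \sum_(n <- mons d M) beta R n * complex.Re (defect (pw n x) (pw n x)) =
  rnorm x ^+ 2 -
    \sum_(n <- mons d M.+1 | mdeg n == M) beta R n * rnorm (pw n x) ^+ 2.
Proof.
have := beta_telescope (fun n => rnorm (pw n x) ^+ 2) M.
have -> : pw mnm0 x = x by rewrite /pw opow0.
move=> <-; apply: eq_bigr => n _; congr (_ * _).
rewrite defectE /=; congr (_ - _); apply: eq_bigr => j _.
by rewrite /pw -opowS.
Qed.

Variable X : set (multinom d).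
Hypothesis X_pw : forall n h, ~ X n -> pw n h = 0.
Variables (Q : mpoly d R[i]) (c : R).
Hypothesis c_ge0 : 0 <= c.
(** The finite content of |Q(B^X)|^2 <= [c]: for [X] closed under divisors, the inner sum is the
    value at [n] of Q(B^X) applied to [g]. *)
Hypothesis Q_bound : forall K M (g : multinom d -> R[i]^o),
  (forall n, g n != 0 -> X n /\ (mdeg n < K)%N) ->
  \sum_(n <- mons d M) beta R n *
     rnorm (\sum_(k <- msupp Q) mcoeff k Q * g (mnm_add n k) : R[i]^o) ^+ 2 <=
  c * \sum_(n <- mons d K) beta R n * rnorm (g n) ^+ 2.

Let Qh h := poly_op (fun j => T j) Q h.

Lemma pw_poly_op n h :
  pw n (Qh h) = \sum_(k <- msupp Q) mcoeff k Q *: pw (mnm_add n k) h.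
Proof.
have pwZ m a x : pw m (a *: x) = a *: pw m x.
  rewrite /pw /opow; elim: (index_enum _) => [|i r IH]; first by rewrite !big_nil.
  rewrite !big_cons /= IH; elim: (m i) => //= k ->; exact: linearZ.
have pwD m : {morph pw m : x y / x + y}.
  rewrite /pw /opow; elim: (index_enum _) => [|i r IH] x y; first by rewrite !big_nil.
  rewrite !big_cons /= IH; elim: (m i) => //= k ->; exact: linearD.
have pw0 m : pw m 0 = 0 by rewrite -[in LHS](scale0r (0 : H)) pwZ scale0r.
rewrite /Qh /poly_op (big_morph _ (pwD n) (pw0 n)); apply: eq_bigr => k _.
by rewrite pwZ /pw opowD // addmC.
Qed.

Lemma defect_poly_bound h M :
  \sum_(n <- mons d M) beta R n * complex.Re (defect (pw n (Qh h)) (pw n (Qh h)))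
  <= c * rnorm h ^+ 2.
Proof.
(* For |n| < M and k in the support of [Q] the degree of n + k stays below [K], so cutting the orbit
   of [h] at degree [K] does not affect T^n Q(T) h. *)
set K := (M + msize Q)%N.
pose W n : H := if (mdeg n < K)%N then pw n h else 0.
have W0 n : n \notin mons d K -> W n = 0.
  by rewrite mem_mons /W => /negPf ->.
have [p [D [g [D0 g0 DE]]]] := gram_finsupp defectl defect_herm defect_ge0 W0.
have DR i : (complex.Re (D i))%:C = D i by rewrite RRe_real // ger0_real.
have DR0 i : 0 <= complex.Re (D i) by rewrite -ler0c DR.
have redE (r : seq (multinom d)) (a : multinom d -> R[i]) e :
    complex.Re (defect (\sum_(k <- r) a k *: W (e k))
      (\sum_(k <- r) a k *: W (e k))) =
    \sum_i complex.Re (D i) *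
      rnorm (\sum_(k <- r) a k * g i (e k) : R[i]^o) ^+ 2.
  rewrite DE; apply: complexI; rewrite rmorph_sum /=.
  rewrite RRe_real; last first.
    by apply: ger0_real; apply: sumr_ge0 => i _; rewrite mulr_ge0 ?exprn_ge0.
  by apply: eq_bigr => i _; rewrite rmorphM rmorphXn /= DR rnormE.
have -> : \sum_(n <- mons d M)
    beta R n * complex.Re (defect (pw n (Qh h)) (pw n (Qh h))) =
  \sum_i complex.Re (D i) * \sum_(n <- mons d M) beta R n *
     rnorm (\sum_(k <- msupp Q) mcoeff k Q * g i (mnm_add n k) : R[i]^o) ^+ 2.
  under [RHS]eq_bigr => i _ do rewrite mulr_sumr.
  rewrite exchange_big /= !big_seq; apply: eq_bigr => n; rewrite mem_mons => nM.
  have -> : pw n (Qh h) = \sum_(k <- msupp Q) mcoeff k Q *: W (mnm_add n k).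
    rewrite pw_poly_op !big_seq; apply: eq_bigr => k /msize_mdeg_lt kQ.
    by rewrite /W mdegD ifT // /K; lia.
  rewrite (redE _ (fun k => mcoeff k Q) (fun k => mnm_add n k)) mulr_sumr.
  by apply: eq_bigr => i _; rewrite mulrCA.
(* At [h] the remainder of the telescoped sum is subtracted and nonnegative, so it can simply be
   dropped. *)
apply: (@le_trans _ _ (c * \sum_(n <- mons d K)
    beta R n * complex.Re (defect (pw n h) (pw n h)))); last first.
  rewrite ler_wpM2l // defect_telescope gerBl sumr_ge0 // => n _.
  by rewrite mulr_ge0 ?sqr_ge0 // ltW // beta_gt0.
have -> : \sum_(n <- mons d K) beta R n * complex.Re (defect (pw n h) (pw n h)) =
  \sum_i complex.Re (D i) *
    \sum_(n <- mons d K) beta R n * rnorm (g i n : R[i]^o) ^+ 2.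
  under [RHS]eq_bigr => i _ do rewrite mulr_sumr.
  rewrite exchange_big /= !big_seq; apply: eq_bigr => n; rewrite mem_mons => nK.
  have -> : pw n h = \sum_(k <- [:: n]) 1 *: W k.
    by rewrite big_seq1 scale1r /W nK.
  rewrite (redE _ (fun=> 1) id) mulr_sumr; apply: eq_bigr => i _.
  by rewrite big_seq1 mul1r mulrCA.
(* Both sides are now combinations of scalar sums with the same weights [D i], and [Q_bound] is
   applied to each [g i]. *)
rewrite mulr_sumr; apply: ler_sum => i _; rewrite mulrCA ler_wpM2l //.
apply: Q_bound => n gn; split.
  apply: contrapT => /X_pw Xn; move/eqP: gn; apply; apply: g0.
  by rewrite /W Xn; case: ifP.
rewrite ltnNge; apply/negP => Kn; move/eqP: gn; apply; apply: g0.
by rewrite /W ltnNge Kn.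
Qed.

(** Telescoping at Q(T) h recovers its squared norm up to a remainder of at most [rho ^+ M] times
    it, and [M] is sent to infinity. *)
Lemma finite_von_neumann h : rnorm (Qh h) ^+ 2 <= c * rnorm h ^+ 2.
Proof.
have H1 M : rnorm (Qh h) ^+ 2 - rho ^+ M * rnorm (Qh h) ^+ 2 <= c * rnorm h ^+ 2.
  apply: le_trans (defect_poly_bound h M); rewrite defect_telescope.
  by rewrite lerD2l lerN2 level_decay.
have : (fun M => rnorm (Qh h) ^+ 2 - rho ^+ M * rnorm (Qh h) ^+ 2) @ \oo -->
   rnorm (Qh h) ^+ 2 - 0 * rnorm (Qh h) ^+ 2.
  apply: cvgB; first exact: cvg_cst.
  by apply: cvgMl; apply: cvg_expr; rewrite ger0_norm.
rewrite mul0r subr0 => cv; rewrite -(cvg_lim _ cv) //.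
apply: limr_le; first by apply/cvg_ex; eexists; exact: cv.
by apply: nearW.
Qed.

End FiniteVonNeumann.

(** * Weighted norms as suprema of finite sums *)

Section WeightedNorm.
Variables (R : realType) (d : nat).
Implicit Types (w : multinom d -> R) (g : multinom d -> R[i]^o).

(** The bridge between norms in [\bar R] and real estimates: an unordered sum of nonnegative terms
    is a supremum over finite index sets. *)
Lemma weighted_norm_leP w g (c : R) : 0 <= c ->
  (weighted_norm w g <= c%:E)%E <->
  (forall s : seq (multinom d), uniq s ->
     \sum_(n <- s) rnorm (g n) ^+ 2 * w n <= c ^+ 2).
Proof.
move=> c0; rewrite /weighted_norm.
have -> : c%:E = sqrte ((c ^+ 2)%:E) by rewrite /= sqrtr_sqr ger0_norm.
rewrite lee_sqrt ?lee_fin ?sqr_ge0 //; split => [le_c s us|le_c].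
  rewrite -lee_fin; apply: le_trans le_c; rewrite -sumEFin.
  rewrite fsbig_seq //; apply: ereal_sup_ubound.
  exists [set` s]; last by [].
  by split => //; exact: finite_seq.
apply: ge_ereal_sup => _ [F [finF _] <-].
rewrite fsbig_finite //= sumEFin lee_fin; apply: le_c; exact: fset_uniq.
Qed.

Lemma weighted_norm_ge0 w g : (0 <= weighted_norm w g)%E.
Proof. exact: sqrte_ge0. Qed.

Lemma rnorm0 (V : normedModType R[i]) : rnorm (0 : V) = 0.
Proof. by rewrite /rnorm normr0. Qed.

Lemma weighted_norm_finsupp w g (s : seq (multinom d)) (c : R) :
    (forall n, 0 <= w n) -> 0 <= c -> uniq s ->
    (forall n, n \notin s -> g n = 0) ->
    \sum_(n <- s) rnorm (g n) ^+ 2 * w n <= c ^+ 2 ->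
  (weighted_norm w g <= c%:E)%E.
Proof.
move=> w0 c0 us gs le_c; apply/weighted_norm_leP => // t ut.
apply: le_trans le_c.
rewrite (bigID (fun n => n \in s)) /= [X in _ + X]big1 ?addr0; last first.
  by move=> n /gs ->; rewrite rnorm0 expr0n mul0r.
rewrite [leRHS](bigID (fun n => n \in t)) /=.
rewrite -[X in X <= _]big_filter -[X in _ <= X + _]big_filter.
have -> : \sum_(n <- [seq n <- t | n \in s]) rnorm (g n) ^+ 2 * w n =
    \sum_(n <- [seq n <- s | n \in t]) rnorm (g n) ^+ 2 * w n.
  apply: perm_big; apply: uniq_perm; rewrite ?filter_uniq // => n.
  by rewrite !mem_filter andbC.
by rewrite lerDl sumr_ge0 // => n _; rewrite mulr_ge0 ?sqr_ge0.
Qed.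

End WeightedNorm.

(** * The compressed backward shift *)

Section BackwardShift.
Variables (R : realType) (d : nat) (X : set (multinom d)).
Hypothesis Xdown : forall n k, X (mnm_add n k) -> X n.

(** If n is outside [X] then so is n + e_j, hence translates of [u] are still supported in [X] and
    the truncation changes nothing. *)
Lemma poly_op_backward_shift (Q : mpoly d R[i]) (u : multinom d -> R[i]^o) n :
    (forall n, ~ X n -> u n = 0) ->
  poly_op (compressed_backward_shift X) Q u n =
    \sum_(k <- msupp Q) mcoeff k Q * u (mnm_add n k).
Proof.
move=> uX; rewrite /poly_op fct_sumE; apply: eq_bigr => k _.
pose U m : multinom d -> R[i]^o := fun p => u (mnm_add p m).
have -> : opow (compressed_backward_shift X) k u = U k.
  have uE : u = U mnm0 by apply: funext => p; rewrite /U addm0.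
  rewrite {1}uE -[in RHS](add0m k); apply: opow_translate => j m.
  apply: funext => p; rewrite /compressed_backward_shift /truncate.
  rewrite /backward_shift /U -addmA (addmC (mnm1 j)).
  case: asboolP => // Xp; rewrite uX // => Xq; exact/Xp/Xdown/Xq.
by [].
Qed.

Lemma l2_bound (Q : mpoly d R[i]) (c : R) : 0 <= c ->
    (opnorm (l2 X) (@l2norm R d) (poly_op (compressed_backward_shift X) Q)
       <= c%:E)%E ->
  forall K M (g : multinom d -> R[i]^o),
  (forall n, g n != 0 -> X n /\ (mdeg n < K)%N) ->
  \sum_(n <- mons d M) beta R n *
     rnorm (\sum_(k <- msupp Q) mcoeff k Q * g (mnm_add n k) : R[i]^o) ^+ 2 <=
  c ^+ 2 * \sum_(n <- mons d K) beta R n * rnorm (g n) ^+ 2.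
Proof.
move=> c0 le_c K M g gK.
have gX n : ~ X n -> g n = 0.
  by move=> Xn; apply/eqP; apply: contrapT => /negP /gK[].
have gs n : n \notin mons d K -> g n = 0.
  by rewrite mem_mons => nK; apply/eqP; apply: contraNT nK => /gK[].
set S := \sum_(n <- mons d K) _.
have S0 : 0 <= S.
  by apply: sumr_ge0 => n _; rewrite mulr_ge0 ?sqr_ge0 // ltW // beta_gt0.
have [S_eq0|S_neq0] := eqVneq S 0.
  have g0 n : g n = 0.
    have [nK|/gs //] := boolP (n \in mons d K).
    move/eqP: S_eq0; rewrite /S psumr_eq0; last first.
      by move=> m _; rewrite mulr_ge0 ?sqr_ge0 // ltW // beta_gt0.
    move=> /allP /(_ _ nK) /=; rewrite mulf_eq0 gt_eqF ?beta_gt0 //= sqrf_eq0.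
    by rewrite -(inj_eq (@complexI R)) rnormE normr_eq0 => /eqP.
  rewrite S_eq0 mulr0 big1 // => n _; rewrite big1 ?rnorm0 ?expr0n ?mulr0 //.
  by move=> k _; rewrite g0 mulr0.
(* [opnorm] only tests vectors of norm at most 1, so [g] is normalised; this is why [S = 0] was
   settled beforehand. *)
pose t : R := (Num.sqrt S)^-1.
have t0 : 0 <= t by rewrite invr_ge0 sqrtr_ge0.
have tS : t ^+ 2 * S = 1 by rewrite exprVn sqr_sqrtr // mulVf.
pose u : multinom d -> R[i]^o := fun n => t%:C * g n.
have uE n : rnorm (u n) ^+ 2 = t ^+ 2 * rnorm (g n) ^+ 2.
  by rewrite /u rnormM rnorm_real // exprMn.
have u1 : (l2norm u <= 1%:E)%E.
  apply: (@weighted_norm_finsupp _ _ _ _ (mons d K)) => //.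
  - by move=> n; rewrite ltW // beta_gt0.
  - exact: mons_uniq.
  - by move=> n /gs; rewrite /u => ->; rewrite mulr0.
  rewrite expr1n -tS mulr_sumr le_eqVlt; apply/orP; left; apply/eqP.
  by apply: eq_bigr => n _; rewrite uE mulrAC -mulrA.
have uX n : ~ X n -> u n = 0 by move=> /gX; rewrite /u => ->; rewrite mulr0.
have : (l2norm (poly_op (compressed_backward_shift X) Q u) <= c%:E)%E.
  apply: le_trans le_c; apply: ereal_sup_ubound; exists u => //; split => //.
  by split => //; rewrite (le_lt_trans u1) // ltry.
move=> /(weighted_norm_leP _ _ c0) /(_ _ (mons_uniq d M)) le_c2.
rewrite -ler_pdivrMr; last by rewrite lt_def S_neq0.
have -> : S^-1 = t ^+ 2 by rewrite exprVn sqr_sqrtr.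
apply: le_trans le_c2; rewrite mulr_suml le_eqVlt; apply/orP; left; apply/eqP.
apply: eq_bigr => n _; rewrite poly_op_backward_shift //.
have -> : \sum_(k <- msupp Q) mcoeff k Q * u (mnm_add n k) =
  t%:C * \sum_(k <- msupp Q) mcoeff k Q * g (mnm_add n k).
  by rewrite mulr_sumr; apply: eq_bigr => k _; rewrite mulrCA.
by rewrite rnormM rnorm_real // exprMn; ring.
Qed.

(** The zero function is always admissible; this rules out the value [-oo] of an empty supremum. *)
Lemma opnorm_l2_ge0 (Q : mpoly d R[i]) :
  (0 <= opnorm (l2 X) (@l2norm R d) (poly_op (compressed_backward_shift X) Q))%E.
Proof.
apply: (@le_trans _ _ (l2norm (poly_op (compressed_backward_shift X) Q 0%R))).
  exact: weighted_norm_ge0.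
have l20 : (l2norm (0%R : multinom d -> R[i]^o) <= 0%:E)%E.
  apply/weighted_norm_leP => // s _; rewrite big1 ?expr0n // => n _.
  by rewrite rnorm0 expr0n mul0r.
apply: ereal_sup_ubound; exists 0 => //; split; last exact: le_trans l20 _.
by split => //; rewrite (le_lt_trans l20) // ltry.
Qed.

End BackwardShift.

(** The limit t -> 0 in the form used below. The witness is the minimum of 1 and e / (S + 1), where
    the [+ 1] avoids a division by zero. *)
Lemma ler_add_small (R : realType) (x y S : R) : 0 <= S ->
  (forall t, 0 < t <= 1 -> x <= y + t * S) -> x <= y.
Proof.
move=> S0 H; apply/ler_addgt0Pr => e e0.
have S1 : 0 < S + 1 by rewrite ltr_wpDl.
have t0 : 0 < Num.min 1 (e / (S + 1)) by rewrite lt_min ltr01 divr_gt0.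
apply: le_trans (H (Num.min 1 (e / (S + 1))) _) _.
  by rewrite t0 ge_min lexx.
rewrite lerD2l; apply: (@le_trans _ _ (e / (S + 1) * S)).
  by rewrite ler_wpM2r // ge_min lexx orbT.
by rewrite mulrAC ler_pdivrMr // ler_wpM2l ?ltW // ltrDl.
Qed.

(** Makes the error of replacing A^k by (r A)^k linear in 1 - r, as [ler_add_small] requires. *)
Lemma bernoulli_one_minus (R : realType) (r : R) m : 0 <= r <= 1 ->
  1 - r ^+ m <= m%:R * (1 - r).
Proof.
move=> /andP[r0 r1]; elim: m => [|m IH]; first by rewrite expr0 subrr mul0r.
have -> : 1 - r ^+ m.+1 = (1 - r) + r * (1 - r ^+ m) by rewrite exprS; ring.
rewrite -natr1 mulrDl mul1r addrC lerD2r; apply: le_trans IH.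
by rewrite ler_piMl // subr_ge0 exprn_ile1.
Qed.

(** * From r A to A *)

Section VonNeumann.
Variables (R : realType) (d : nat) (H : normedModType R[i]).
Variable ip : {dot H for Num.conj}.
Hypothesis norm_ip : forall h : H, `|h| ^+ 2 = ip h h.
Variable A : 'I_d -> {linear H -> H}.
Hypothesis A_comm : forall i j h, A i (A j h) = A j (A i h).
Hypothesis A_contr : forall h, \sum_(j < d) `|A j h| ^+ 2 <= `|h| ^+ 2.
Variable X : set (multinom d).
Hypothesis X_def : X = ~` [set n | forall h, opow (fun j => A j) n h = 0].

Lemma nonvanishing_down n k : X (mnm_add n k) -> X n.
Proof.
rewrite X_def => /= H1 H2; apply: H1 => h.
by rewrite addmC -opowD // H2.
Qed.

Lemma dilated_opow (r : R) n h :
  opow (fun j => (r%:C \*: A j) : {linear H -> H}) n h =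
  (r ^+ mdeg n)%:C *: opow (fun j => A j) n h.
Proof.
pose u m := (r ^+ mdeg m)%:C *: opow (fun j => A j) m h.
have <- : u mnm0 = h by rewrite /u mdeg0 expr0 scale1r opow0.
rewrite (opow_translate (u := u)) ?add0m.
  by rewrite /u mdeg0 expr0 scale1r opow0.
move=> j m; rewrite /u /= linearZ /= -opowS // scalerA; congr (_ *: _).
by rewrite mdegD mdeg1 addn1 exprS rmorphM.
Qed.

Lemma von_neumann (Q : mpoly d R[i]) :
  (opnorm setT (fun h => (rnorm h)%:E) (poly_op (fun j => A j) Q)
     <= opnorm (l2 X) (@l2norm R d) (poly_op (compressed_backward_shift X) Q))%E.
Proof.
have := opnorm_l2_ge0 X Q.
set C := opnorm (l2 X) _ _; case CE : C => [c| |] // c0; last by rewrite leey.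
rewrite lee_fin in c0.
have le_c : (opnorm (l2 X) (@l2norm R d)
    (poly_op (compressed_backward_shift X) Q) <= c%:E)%E by rewrite -CE.
have bound := l2_bound nonvanishing_down c0 le_c.
apply: ge_ereal_sup => _ [h [_ h1] <-]; rewrite lee_fin in h1.
rewrite lee_fin; apply: (@le_trans _ _ (c * rnorm h)); last by rewrite ler_piMr.
pose a k := rnorm (mcoeff k Q *: opow (fun j => A j) k h).
(* With r = 1 - t, passing from r A to A costs at most [t] times this sum, which depends on [h] and
   [Q] but not on [t]. *)
apply: (@ler_add_small _ _ _ (\sum_(k <- msupp Q) (mdeg k)%:R * a k)).
  by apply: sumr_ge0 => k _; rewrite mulr_ge0 // rnorm_ge0.
move=> t /andP[t0 t1]; pose r := 1 - t.
have r0 : 0 <= r by rewrite subr_ge0.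
have r1 : r < 1 by rewrite /r gtrBl.
pose T j : {linear H -> H} := r%:C \*: A j.
have Tcomm i j x : T i (T j x) = T j (T i x).
  by rewrite /T /= !linearZ /= A_comm !scalerA mulrC.
have Tcontr x : \sum_(j < d) rnorm (T j x) ^+ 2 <= r ^+ 2 * rnorm x ^+ 2.
  under eq_bigr => j _ do rewrite /T /= rnormZ rnorm_real // exprMn.
  rewrite -mulr_sumr ler_wpM2l ?sqr_ge0 // -lecR rmorph_sum /=.
  under eq_bigr => j _ do rewrite rmorphXn /= rnormE.
  by rewrite rmorphXn /= rnormE.
have vanish n x : ~ X n -> opow (fun j => T j) n x = 0.
  rewrite X_def /= => /contrapT /= Xn.
  by rewrite dilated_opow Xn scaler0.
have := finite_von_neumann norm_ip Tcomm (sqr_ge0 r) _ Tcontr vanish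
  (sqr_ge0 c) bound h.
rewrite -exprMn ler_sqr ?nnegrE ?mulr_ge0 ?rnorm_ge0 // => H1.
have -> : poly_op (fun j => A j) Q h = poly_op (fun j => T j) Q h +
    \sum_(k <- msupp Q) (1 - r ^+ mdeg k)%:C *:
       (mcoeff k Q *: opow (fun j => A j) k h).
  rewrite /poly_op -big_split /=; apply: eq_bigr => k _.
  rewrite dilated_opow rmorphB rmorph1 scalerBl scale1r !scalerA mulrC.
  by rewrite addrC subrK.
apply: le_trans (rnormD _ _) _; apply: lerD.
  by apply: H1; rewrite expr_lt1.
rewrite mulr_sumr; elim: (msupp Q) => [|k s IH]; first by rewrite !big_nil rnorm0.
rewrite !big_cons; apply: le_trans (rnormD _ _) _; apply: lerD => //.
have rk : r ^+ mdeg k <= 1 by rewrite exprn_ile1 // ltW.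
rewrite rnormZ rnorm_real ?subr_ge0 // mulrA ler_wpM2r ?rnorm_ge0 //.
have -> : t = 1 - r by rewrite /r opprB addrC subrK.
by rewrite mulrC bernoulli_one_minus // r0 ltW.
Qed.

End VonNeumann.

(** * Uniqueness of Taylor expansions *)

Section UnorderedSums.
Variables (R : realType) (I : choiceType).
Implicit Types (x : I -> R[i]^o) (J : {fset I}).

Lemma partial_sumE (V : zmodType) (x : I -> V) J :
  summability.partial_sum x J = \sum_(i <- J) x i.
Proof. by rewrite /summability.partial_sum big_seq_fsetE. Qed.

Lemma totally_cvgP x (l : R[i]^o) :
  summability.partial_sum x @ summability.totally --> l <->
  forall e : R, 0 < e -> exists J0, forall J, fsubset J0 J ->
    rnorm (\sum_(i <- J) x i - l : R[i]^o) < e.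
Proof.
split=> [/cvgrPdist_lt cvx e e0|H].
  have [J0 _ J0P] := cvx e%:C (ltac:(by rewrite ltcR)).
  by exists J0 => J /J0P /=; rewrite partial_sumE distrC -rnormE ltcR.
apply/cvgrPdist_lt => e e0.
have eE : e = (complex.Re e)%:C by rewrite RRe_real // gtr0_real.
have [|J0 J0P] := H (complex.Re e); first by rewrite -ltcR -eE.
exists J0 => // J /J0P /=.
by rewrite partial_sumE distrC -ltcR rnormE -eE.
Qed.

Lemma rnorm_Re (z : R[i]^o) : `|complex.Re z| <= rnorm z.
Proof.
rewrite /rnorm normc_def /= -sqrtr_sqr ler_wsqrtr // lerDl sqr_ge0 //.
Qed.

Lemma rnorm_Im (z : R[i]^o) : `|complex.Im z| <= rnorm z.
Proof.
rewrite /rnorm normc_def /= -sqrtr_sqr ler_wsqrtr // lerDr sqr_ge0 //.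
Qed.

Lemma rnorm_le_ReIm (z : R[i]^o) :
  rnorm z <= `|complex.Re z| + `|complex.Im z|.
Proof.
rewrite /rnorm normc_def /=.
rewrite -[leRHS]ger0_norm ?addr_ge0 // -[leRHS]sqrtr_sqr ler_wsqrtr //.
by rewrite sqrrD !real_normK ?num_real // lerD2r lerDl mulrn_wge0 // mulr_ge0.
Qed.

(** The terms of one sign form a single subset sum, so two subset sums account for all absolute
    values. *)
Lemma sum_norm_le2 (y : I -> R) (s : seq I) (c : R) :
    (forall P : pred I, `|\sum_(i <- s | P i) y i| <= c) ->
  \sum_(i <- s) `|y i| <= 2 * c.
Proof.
move=> yc; rewrite (bigID (fun i => 0 <= y i)) /= mulr_natl mulr2n.
apply: lerD.
  rewrite (eq_bigr y); last by move=> i /ger0_norm.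
  exact: le_trans (ler_norm _) (yc _).
rewrite (eq_bigr (fun i => - y i)); last first.
  by move=> i; rewrite -ltNge => /ltr0_norm.
by rewrite sumrN; apply: le_trans (ler_norm _) _; rewrite normrN.
Qed.

(* In finite dimension unordered convergence is absolute. *)
Lemma totally_cvg_absolute x (l : R[i]^o) :
    summability.partial_sum x @ summability.totally --> l ->
  exists M : R, forall J, \sum_(i <- J) rnorm (x i) <= M.
Proof.
move=> /totally_cvgP /(_ 1 ltr01) [J0 J0P].
(* Two partial sums over sets containing [J0] are both within 1 of [l]; their difference is an
   arbitrary finite sum off [J0]. *)
have sub2 (s : seq I) : uniq s -> (forall i, i \in s -> i \notin J0) ->
    rnorm (\sum_(i <- s) x i : R[i]^o) <= 2.
  move=> us sJ0; have := J0P J0 (fsubset_refl _).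
  have := J0P (fsetU J0 (seq_fset tt s)) (fsubsetUl _ _).
  have -> : \sum_(i <- fsetU J0 (seq_fset tt s)) x i =
      \sum_(i <- J0) x i + \sum_(i <- s) x i.
    rewrite -big_cat; apply: perm_big; apply: uniq_perm.
    - exact: fset_uniq.
    - rewrite cat_uniq fset_uniq us /= andbT; apply/hasPn => i /sJ0 //.
    - by move=> i; rewrite mem_cat inE seq_fsetE.
  set a := \sum_(i <- J0) x i; set b := \sum_(i <- s) x i => h1 h2.
  have -> : b = (a + b - l) + (-1) *: (a - l).
    by rewrite scaleN1r; ring.
  apply: le_trans (rnormD _ _) _; rewrite rnormZ.
  have -> : rnorm (-1 : R[i]^o) = 1 :> R.
    by apply: complexI; rewrite rnormE normrN1.
  by rewrite mul1r -[2]/(1 + 1) lerD ?ltW.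
(* Off [J0] all subset sums are bounded by 2, so [sum_norm_le2] gives 2 * 2 for the real parts and
   again for the imaginary parts. *)
exists (\sum_(i <- J0) rnorm (x i) + (2 * 2 + 2 * 2)) => J.
rewrite (bigID (fun i => i \in J0)) /= lerD //.
  rewrite -big_filter.
  rewrite [leRHS](bigID (fun i => i \in J)) /= -[X in _ <= X + _]big_filter.
  have -> : \sum_(i <- [seq i <- J | i \in J0]) rnorm (x i) =
      \sum_(i <- [seq i <- J0 | i \in J]) rnorm (x i).
    apply: perm_big; apply: uniq_perm; rewrite ?filter_uniq ?fset_uniq // => i.
    by rewrite !mem_filter andbC.
  by rewrite lerDl sumr_ge0 // => i _; rewrite rnorm_ge0.
rewrite -big_filter; set s := [seq _ <- _ | _].
have sP (P : pred I) : rnorm (\sum_(i <- s | P i) x i : R[i]^o) <= 2.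
  rewrite -big_filter; apply: sub2; first by rewrite !filter_uniq ?fset_uniq.
  by move=> i; rewrite !mem_filter => /and3P[].
apply: le_trans (ler_sum _ (fun i _ => rnorm_le_ReIm (x i))) _.
rewrite big_split /= lerD // sum_norm_le2 // => P.
- have <- : complex.Re (\sum_(i <- s | P i) x i) = \sum_(i <- s | P i) complex.Re (x i).
    exact: (raddf_sum (@complex.Re R : {additive _ -> _})).
  exact: le_trans (rnorm_Re _) (sP P).
- have <- : complex.Im (\sum_(i <- s | P i) x i) = \sum_(i <- s | P i) complex.Im (x i).
    exact: (raddf_sum (@complex.Im R : {additive _ -> _})).
  exact: le_trans (rnorm_Im _) (sP P).
Qed.

Lemma rnorm_sum (T : Type) (s : seq T) (P : pred T) (y : T -> R[i]^o) :
  rnorm (\sum_(i <- s | P i) y i : R[i]^o) <= \sum_(i <- s | P i) rnorm (y i).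
Proof.
elim: s => [|i s IH]; first by rewrite !big_nil rnorm0.
rewrite !big_cons; case: ifP => // _; apply: le_trans (rnormD _ _) _.
by rewrite lerD2l.
Qed.

(* Where w is injective, the leading term of the power series in u dominates. *)
Lemma power_series_eq0 x (w : I -> nat) (V : nat) (M : R) :
    (forall J, \sum_(i <- J) rnorm (x i) <= M) ->
    (forall u : R, 0 < u <= 1 ->
       summability.partial_sum (fun i => x i * (u ^+ w i)%:C : R[i]^o)
         @ summability.totally --> (0 : R[i]^o)) ->
    (forall i k, w i = w k -> (w i < V)%N -> i = k) ->
  forall i, (w i < V)%N -> x i = 0.
Proof.
move=> xM cvx w_inj i.
have [v] := ubnP (w i); elim: v i => // v IH i wv wV.
have M0 : 0 <= M by have := xM fset0; rewrite big_seq_fset0.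
apply/eqP; rewrite -normr_eq0 -rnormE (inj_eq (@complexI R)).
rewrite eq_le rnorm_ge0 andbT.
(* It is enough to bound [rnorm (x i)] by [u * M] for every [u] in (0, 1]; this is then multiplied
   by [u ^+ w i]. *)
apply: (ler_add_small M0) => u /andP[u0 u1]; rewrite add0r.
rewrite -(ler_pM2r (exprn_gt0 (w i) u0)); apply/ler_addgt0Pr => e e0.
have /totally_cvgP /(_ e e0) [J0 J0P] := cvx u (ltac:(by rewrite u0)).
have := J0P (fsetU J0 (fset1 i)) (fsubsetUl _ _).
set J := fsetU _ _; rewrite subr0.
have iJ : i \in J by rewrite !inE eqxx orbT.
rewrite (bigD1_seq i) ?fset_uniq //=; set rest := \sum_(k <- J | _) _ => Je.
(* Terms of smaller weight vanish by induction, no other term has weight [w i], and the remaining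
   ones carry at least one more factor [u]. *)
have rest_le : rnorm rest <= u * M * u ^+ w i.
  apply: le_trans (rnorm_sum _ _ _) _.
  apply: (@le_trans _ _ (\sum_(k <- J | k != i) rnorm (x k) * u ^+ (w i).+1)).
    apply: ler_sum => k ki; rewrite rnormM rnorm_real ?exprn_ge0 ?(ltW u0) //.
    have [kv|] := ltnP (w k) (w i).
      rewrite IH ?rnorm0 ?mul0r //; first by apply: leq_trans kv _; rewrite -ltnS.
      exact: ltn_trans kv wV.
    rewrite leq_eqVlt => /orP[/eqP wE|wk].
      by move/eqP: ki; case; apply/esym/w_inj.
    by rewrite ler_wpM2l ?rnorm_ge0 // ler_wiXn2l // ltW.
  rewrite -mulr_suml exprS mulrA [u * M]mulrC ler_wpM2r ?exprn_ge0 ?(ltW u0) //.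
  rewrite ler_wpM2r ?(ltW u0) //; apply: le_trans (xM J).
  by rewrite [leRHS](bigD1_seq i) ?fset_uniq //= lerDr rnorm_ge0.
have -> : rnorm (x i) * u ^+ w i = rnorm (x i * (u ^+ w i)%:C : R[i]^o).
  by rewrite rnormM rnorm_real // exprn_ge0 // ltW.
set lead := (x i * _ : R[i]^o) in Je *.
have -> : lead = (lead + rest) + (-1) *: rest by rewrite scaleN1r; ring.
apply: le_trans (rnormD _ _) _; rewrite rnormZ.
have -> : rnorm (-1 : R[i]^o) = 1 :> R.
  by apply: complexI; rewrite rnormE normrN1.
by rewrite mul1r addrC lerD // ltW.
Qed.

End UnorderedSums.

(** * Base-B weights separating the monomials of low degree *)

Lemma digits_inj (B k : nat) (f g : nat -> nat) :
    (forall i, (i < k)%N -> (f i < B)%N /\ (g i < B)%N) ->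
    (\sum_(i < k) f i * B ^ i = \sum_(i < k) g i * B ^ i)%N ->
  forall i, (i < k)%N -> f i = g i.
Proof.
elim: k f g => [//|k IH] f g fgB.
have step (h : nat -> nat) : (\sum_(i < k.+1) h i * B ^ i =
    (\sum_(i < k) h i.+1 * B ^ i) * B + h 0)%N.
  rewrite big_ord_recl expn0 muln1 addnC big_distrl /=; congr (_ + _)%N.
  by apply: eq_bigr => i _; rewrite -mulnA -expnSr.
rewrite !step => e.
have [f0 g0] := fgB 0%N isT.
have B0 : (0 < B)%N by exact: leq_ltn_trans f0.
have /(congr1 (modn^~ B)) := e; rewrite /= !modnMDl !modn_small // => e0.
move: e; rewrite e0 => /addIn /eqP; rewrite eqn_pmul2r // => /eqP e.
case=> [//|i] ik; apply: (IH (fun i => f i.+1) (fun i => g i.+1)) => // l lk.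
exact: fgB.
Qed.

Lemma digits_lt (B k : nat) (f : nat -> nat) :
  (forall i, (i < k)%N -> (f i < B)%N) -> (\sum_(i < k) f i * B ^ i < B ^ k)%N.
Proof.
elim: k => [|k IH] fB; first by rewrite big_ord0.
rewrite big_ord_recr /= expnS.
have fk : ((f k).+1 * B ^ k <= B * B ^ k)%N by rewrite leq_mul2r fB // orbT.
apply: leq_trans fk; rewrite mulSn ltn_add2r IH // => i ik.
by apply: fB; exact: ltn_trans ik _.
Qed.

Section Weight.
Variables (d B : nat).

(** The summand [B ^ d] puts the total degree into the top digit. With the weights [B ^ j] alone, B
    e_0 and e_1 would collide. *)
Definition radix_weight (n : multinom d) : nat :=
  (\sum_(j < d) n j * (B ^ d + B ^ j))%N.

(** The tuple [n] has length [d], so the default value of [nth] supplies the top digit [mdeg n] at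
    position [d]. *)
Lemma radix_weightE n :
  radix_weight n = (\sum_(i < d.+1) nth (mdeg n) n i * B ^ i)%N.
Proof.
rewrite big_ord_recr /= nth_default ?size_tuple // mdegE big_distrl /=.
rewrite /radix_weight; under [LHS]eq_bigr => j _ do rewrite mulnDr.
rewrite big_split /= addnC; congr (_ + _)%N.
by apply: eq_bigr => j _; rewrite -mnm_nth.
Qed.

Lemma mdeg_radix_weight (n : multinom d) : (mdeg n * B ^ d <= radix_weight n)%N.
Proof.
rewrite mdegE big_distrl /=; apply: leq_sum => j _.
by rewrite leq_mul2l leq_addr orbT.
Qed.

Lemma digit_lt (n : multinom d) i : (mdeg n < B)%N -> (i < d.+1)%N ->
  (nth (mdeg n) n i < B)%N.
Proof.
move=> nB; rewrite ltnS leq_eqVlt => /orP[/eqP ->|id].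
  by rewrite nth_default ?size_tuple.
rewrite (_ : i = val (Ordinal id)) // -mnm_nth; apply: leq_ltn_trans nB.
by rewrite mdegE (bigD1 (Ordinal id)) //= leq_addr.
Qed.

Lemma radix_weight_lt (n : multinom d) :
  (mdeg n < B)%N -> (radix_weight n < B ^ d.+1)%N.
Proof.
move=> nB; rewrite radix_weightE; apply: digits_lt => i; exact: digit_lt.
Qed.

(** A weight below [B ^ d.+1] forces the degree, hence all digits, below [B]. By the equality this
    holds for [m] too, and both weights are genuine base-[B] expansions. *)
Lemma radix_weight_inj (n m : multinom d) :
  radix_weight n = radix_weight m -> (radix_weight n < B ^ d.+1)%N ->
  n = m.
Proof.
move=> e nB.
have [B0|B0] := posnP B; first by move: nB; rewrite B0 exp0n.
have deg p : (radix_weight p < B ^ d.+1)%N -> (mdeg p < B)%N.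
  move=> pB; have := leq_ltn_trans (mdeg_radix_weight p) pB.
  by rewrite expnS ltn_pmul2r // expn_gt0 B0.
move: (e); rewrite !radix_weightE => /digits_inj H; apply/mnmP => j.
rewrite (mnm_nth (mdeg n)) (mnm_nth (mdeg m)); apply: H; last first.
  exact: ltn_trans (ltn_ord j) _.
by move=> i id; split; apply: digit_lt => //; apply: deg; rewrite -?e.
Qed.

End Weight.

(** * Taylor expansions on the ball *)

Section Taylor.
Variables (R : realType) (d : nat).
Implicit Types (a b : multinom d -> R[i]^o) (f g : unit_ball R d -> R[i]^o).

Lemma taylor_expansionP f a : taylor_expansion f a <->
  forall z (e : R), 0 < e -> exists J0 : {fset multinom d}, forall J,
    fsubset J0 J -> rnorm (\sum_(n <- J) a n * monomial n z - f z : R[i]^o) < e.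
Proof. by split=> H z; [apply/totally_cvgP|apply/totally_cvgP/H]. Qed.

Lemma eq_taylor_expansion f g a b : g =1 f -> b =1 a -> taylor_expansion f a ->
  taylor_expansion g b.
Proof. by move=> /funext -> /funext ->. Qed.

Lemma taylor_expansionD f g a b : taylor_expansion f a -> taylor_expansion g b ->
  taylor_expansion (fun z => f z + g z) (fun n => a n + b n).
Proof.
move=> /taylor_expansionP fa /taylor_expansionP gb; apply/taylor_expansionP.
move=> z e e0; have e2 : 0 < e / 2 by rewrite divr_gt0.
have [J1 J1P] := fa z _ e2; have [J2 J2P] := gb z _ e2.
exists (fsetU J1 J2) => J; rewrite fsubUset => /andP[/J1P h1 /J2P h2].
under eq_bigr => n _ do rewrite mulrDl.
rewrite big_split /= opprD addrACA (splitr e).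
by apply: le_lt_trans (rnormD _ _) _; exact: ltrD.
Qed.

Lemma taylor_expansionZ f a (c : R[i]^o) : taylor_expansion f a ->
  taylor_expansion (fun z => c * f z) (fun n => c * a n).
Proof.
move=> /taylor_expansionP fa; apply/taylor_expansionP => z e e0.
have c1 : 0 < rnorm c + 1 by rewrite ltr_wpDl // rnorm_ge0.
have [J1 J1P] := fa z _ (divr_gt0 e0 c1).
exists J1 => J /J1P; rewrite ltr_pdivlMr // => h.
under eq_bigr => n _ do rewrite -mulrA.
rewrite -mulr_sumr -mulrBr rnormM; apply: le_lt_trans h.
by rewrite mulrC ler_wpM2l ?rnorm_ge0 // lerDl.
Qed.

Lemma taylor_expansion0 : @taylor_expansion R d (fun=> 0) (fun=> 0).
Proof.
apply/taylor_expansionP => z e e0; exists fset0 => J _.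
by rewrite big1 ?subrr ?rnorm0 // => n _; rewrite mul0r.
Qed.

Lemma taylor_expansion_sum (T : Type) (s : seq T)
    (F : T -> unit_ball R d -> R[i]^o) (c : T -> multinom d -> R[i]^o) :
    (forall t, taylor_expansion (F t) (c t)) ->
  taylor_expansion (fun z => \sum_(t <- s) F t z) (fun n => \sum_(t <- s) c t n).
Proof.
move=> Fc; elim: s => [|t s IH].
  apply: eq_taylor_expansion taylor_expansion0 => [z|n]; exact: big_nil.
apply: eq_taylor_expansion (taylor_expansionD (Fc t) IH) => [z|n];
  exact: big_cons.
Qed.

Lemma monomialD n m (z : unit_ball R d) :
  monomial (mnm_add n m) z = monomial n z * monomial m z.
Proof.
by rewrite /monomial -big_split /=; apply: eq_bigr => j _; rewrite mnmDE exprD.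
Qed.

Lemma monomial0 (z : unit_ball R d) : monomial mnm0 z = 1.
Proof. by rewrite /monomial big1 // => j _; rewrite mnm0E expr0. Qed.

Lemma monomial1 j : monomial (mnm1 j) = @coordinate R d j.
Proof.
apply: funext => z; rewrite /monomial (bigD1 j) //= mnm1E eqxx expr1.
rewrite big1 ?mulr1 // => i ij; rewrite mnm1E eq_sym (negPf ij) expr0 //.
Qed.

Lemma taylor_expansion_shift f a m : taylor_expansion f a ->
  taylor_expansion (fun z => monomial m z * f z)
    (fun n => if mpoly.lem m n then a (mnm_sub n m) else 0).
Proof.
move=> /taylor_expansionP fa; apply/taylor_expansionP => z e e0.
have c1 : 0 < rnorm (monomial m z) + 1 by rewrite ltr_wpDl // rnorm_ge0.
have [J1 J1P] := fa z _ (divr_gt0 e0 c1).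
exists (seq_fset tt [seq mnm_add n m | n <- J1]) => J J1J.
(* The index set [J] is divided by [m]. It contains the translate of [J1], so the quotients contain
   [J1], and indices not divisible by [m] have coefficient 0. *)
pose s := [seq mnm_sub n m | n <- J & mpoly.lem m n].
have us : uniq s.
  rewrite map_inj_in_uniq ?filter_uniq ?fset_uniq // => p q.
  rewrite !mem_filter => /andP[mp _] /andP[mq _] pq.
  by rewrite -(submK mp) -(submK mq) pq.
have J1s : fsubset J1 (seq_fset tt s).
  apply/fsubsetP => n nJ1; rewrite seq_fsetE; apply/mapP.
  exists (mnm_add n m); last by rewrite addmK.
  rewrite mem_filter lem_addl /=; apply: (fsubsetP J1J).
  by rewrite seq_fsetE; apply/mapP; exists n.
have := J1P _ J1s; rewrite ltr_pdivlMr // => h.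
have -> : \sum_(n <- J)
    (if mpoly.lem m n then a (mnm_sub n m) else 0) * monomial n z =
  monomial m z * \sum_(n <- seq_fset tt s) a n * monomial n z.
  have -> : \sum_(n <- seq_fset tt s) a n * monomial n z =
      \sum_(n <- s) a n * monomial n z.
    apply: perm_big; apply: uniq_perm; rewrite ?fset_uniq // => n.
    by rewrite seq_fsetE.
  rewrite big_map big_filter mulr_sumr [RHS]big_mkcond /=.
  apply: eq_bigr => n _; case: ifP => [mn|]; last by rewrite mul0r.
  by rewrite -{2}(submK mn) monomialD; ring.
rewrite -mulrBr rnormM; apply: le_lt_trans h.
by rewrite mulrC ler_wpM2l ?rnorm_ge0 // lerDl.
Qed.

Lemma taylor_expansion_monomial m :
  taylor_expansion (@monomial R d m) (fun n => (n == m)%:R).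
Proof.
apply/taylor_expansionP => z e e0; exists (fset1 m) => J.
rewrite fsub1set => mJ; rewrite (bigD1_seq m) ?fset_uniq //= eqxx mul1r.
by rewrite big1 ?addr0 ?subrr ?rnorm0 // => n /negPf ->; rewrite mul0r.
Qed.

(** Each squared modulus is at most [x], so the sum is at most d / (d + 1). *)
Lemma axis_point_proof (x : R) (w : 'I_d -> nat) : 0 <= x -> x <= d.+1%:R^-1 ->
    (forall j, 0 < w j)%N ->
  \sum_(j < d) `|(\row_j (x ^+ w j)%:C : 'rV[R[i]]_d) 0 j| ^+ 2 < 1.
Proof.
move=> x0 xs w0; have d1 : (0 : R) < d.+1%:R by rewrite ltr0Sn.
have x1 : x <= 1 by apply: le_trans xs _; rewrite invf_le1 // ler1n.
apply: (@le_lt_trans _ _ (\sum_(j < d) (d.+1%:R^-1)%:C)).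
  apply: ler_sum => j _; rewrite mxE ger0_norm ?ler0c ?exprn_ge0 //.
  rewrite -rmorphXn lecR -exprM; apply: le_trans xs.
  rewrite -[leRHS]expr1; apply: ler_wiXn2l => //.
  by rewrite muln_gt0 w0.
rewrite sumr_const card_ord -rmorphMn -[ltRHS]/((1 : R)%:C) ltcR.
by rewrite -[_ *+ d]mulr_natr mulrC ltr_pdivrMr // mul1r ltr_nat.
Qed.

(* On the curve z_j = x ^ (B ^ d + B ^ j) the monomials of degree < B become
   distinct powers of x, smaller than those of all other monomials. *)
Lemma taylor_expansion_eq0 a : taylor_expansion (fun=> 0) a -> a = fun=> 0.
Proof.
move=> a0; apply: funext => n; pose B := (mdeg n).+1.
pose w (j : 'I_d) := (B ^ d + B ^ j)%N.
have w0 (j : 'I_d) : (0 < w j)%N by rewrite addn_gt0 expn_gt0.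
pose s : R := d.+1%:R^-1.
have s0 : 0 < s by rewrite invr_gt0 ltr0Sn.
have pt (u : R) : 0 < u <= 1 -> exists z : unit_ball R d, forall m,
    monomial m z = ((s * u) ^+ radix_weight B m)%:C.
  move=> /andP[u0 u1].
  have x0 : 0 <= s * u by rewrite mulr_ge0 // ltW.
  have xs : s * u <= d.+1%:R^-1 by rewrite ler_piMr // ltW.
  exists (exist (fun z : 'rV[R[i]]_d => is_true (\sum_(j < d) `|z 0 j| ^+ 2 < 1))
    _ (axis_point_proof x0 xs w0)) => m.
  rewrite /monomial /coordinate /= /radix_weight -prodrXr rmorph_prod.
  by apply: eq_bigr => j _; rewrite mxE -rmorphXn -exprM mulnC.
(* The scale [s], which keeps the curve inside the ball, is absorbed into the coefficients; [u] then
   runs through all of (0, 1], and [u = 1] yields the absolute bound. *)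
pose x m : R[i]^o := a m * (s ^+ radix_weight B m)%:C.
have cvx (u : R) : 0 < u <= 1 ->
    summability.partial_sum (fun m => x m * (u ^+ radix_weight B m)%:C : R[i]^o)
         @ summability.totally --> (0 : R[i]^o).
  move=> /pt [z zE]; have := a0 z.
  under [X in summability.partial_sum X]eq_fun => m
    do rewrite zE exprMn rmorphM mulrA.
  by [].
have [M xM] : exists M : R, forall J : {fset multinom d},
    \sum_(m <- J) rnorm (x m) <= M.
  have := cvx 1 (ltac:(by rewrite ltr01 lexx)).
  under [X in summability.partial_sum X]eq_fun => m
    do rewrite expr1n rmorph1 mulr1.
  by move=> /totally_cvg_absolute.
have := power_series_eq0 xM cvx (@radix_weight_inj d B).
move=> /(_ n); rewrite /x => H.
have nB : (radix_weight B n < B ^ d.+1)%N by exact: radix_weight_lt.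
move/eqP: (H nB); rewrite mulf_eq0 => /orP[/eqP //|].
by rewrite -[0]/((0 : R)%:C) (inj_eq (@complexI R)) expf_eq0 gt_eqF ?andbF.
Qed.

Lemma taylor_expansion_unique f a b :
  taylor_expansion f a -> taylor_expansion f b -> a = b.
Proof.
move=> fa fb.
have ab0 : taylor_expansion (fun=> 0) (fun n => a n + -1 * b n).
  apply: eq_taylor_expansion (taylor_expansionD fa (taylor_expansionZ (c := -1) fb)).
    by move=> z; rewrite mulN1r subrr.
  by [].
have e := taylor_expansion_eq0 ab0.
apply: funext => n; apply/eqP; rewrite -subr_eq0 -mulN1r.
by apply/eqP; exact: (congr1 (@^~ n) e).
Qed.

Lemma taylorE f a : taylor_expansion f a -> taylor f = a.
Proof.
move=> fa; apply: (@taylor_expansion_unique f) => //.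
by apply: (@xgetPex _ (fun=> 0) [set b | taylor_expansion f b]); exists a.
Qed.

Lemma Hd_normE f a : taylor_expansion f a ->
  Hd_norm f = weighted_norm (fun n => (beta R n)^-1) a.
Proof.
move=> fa; rewrite /Hd_norm ifT ?(taylorE fa) //.
by apply/asboolP; exists a.
Qed.

Lemma Hd_norm_ge0 f : (0 <= Hd_norm f)%E.
Proof. by rewrite /Hd_norm; case: ifP => // _; exact: weighted_norm_ge0. Qed.

Lemma Hd_norm_expansion f : (Hd_norm f < +oo)%E -> taylor_expansion f (taylor f).
Proof.
rewrite /Hd_norm; case: ifP => // /asboolP [a fa] _.
by rewrite (taylorE fa).
Qed.

Lemma taylor_expansion_finsupp a (s : seq (multinom d)) : uniq s ->
    (forall n, n \notin s -> a n = 0) ->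
  taylor_expansion (fun z => \sum_(n <- s) a n * monomial n z) a.
Proof.
move=> us as0; apply/taylor_expansionP => z e e0.
exists (seq_fset tt s) => J sJ.
rewrite (bigID (fun n => n \in s)) /= [X in _ + X - _]big1 ?addr0; last first.
  by move=> n /as0 ->; rewrite mul0r.
rewrite -big_filter (_ : \sum_(n <- _) _ = \sum_(n <- s) a n * monomial n z).
  by rewrite subrr rnorm0.
apply: perm_big; apply: uniq_perm; rewrite ?filter_uniq ?fset_uniq // => n.
rewrite mem_filter; apply: andb_idr => ns; apply: (fsubsetP sJ).
by rewrite seq_fsetE.
Qed.

End Taylor.

(** * Multipliers and the compressed shift *)

Section Multipliers.
Variables (R : realType) (d : nat) (X : set (multinom d)).
Hypothesis Xdown : forall n k, X (mnm_add n k) -> X n.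
Hypothesis X0 : X mnm0.
Implicit Types (a : multinom d -> R[i]^o) (f phi : unit_ball R d -> R[i]^o).

Lemma Hd_proj_finsupp f a (s : seq (multinom d)) : uniq s ->
    (forall n, n \notin s -> a n = 0) -> taylor_expansion f a ->
  Hd_proj X f = fun z => \sum_(n <- s) truncate X a n * monomial n z.
Proof.
move=> us as0 fa; apply: funext => z; rewrite /Hd_proj (taylorE fa).
apply: cvg_lim; first exact: norm_hausdorff.
apply: (taylor_expansion_finsupp us) => n /as0.
by rewrite /truncate; case: asboolP.
Qed.

Let chi : multinom d -> R[i]^o := truncate X (fun=> 1).

(** These functions are the orbit of the constant 1 under the compressed shift. *)
Let monomialX n : unit_ball R d -> R[i]^o := fun z => chi n * monomial n z.

Lemma monomialX_expansion n :
  taylor_expansion (monomialX n) (fun m => chi n * (m == n)%:R).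
Proof. exact: taylor_expansionZ (@taylor_expansion_monomial R d n). Qed.

(** If n is outside [X], so is n + e_j and both sides vanish; otherwise the projection decides by
    the membership of n + e_j. *)
Lemma compressed_shift_monomialX j n :
  compressed_shift X j (monomialX n) = monomialX (mnm_add n (mnm1 j)).
Proof.
have e : taylor_expansion (mult_op (@coordinate R d j) (monomialX n))
    (fun m => chi n * (m == mnm_add n (mnm1 j))%:R).
  apply: eq_taylor_expansion (taylor_expansionZ (c := chi n)
    (@taylor_expansion_monomial R d (mnm_add n (mnm1 j)))) => //.
  by move=> z; rewrite monomialD monomial1 /mult_op /monomialX; ring.
rewrite /compressed_shift (Hd_proj_finsupp (s := [:: mnm_add n (mnm1 j)]) _ _ e) //.
  apply: funext => z; rewrite big_seq1 /monomialX /chi /truncate eqxx mulr1.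
  case: asboolP => // Xn; rewrite asboolT //; exact: Xdown Xn.
by move=> m; rewrite inE => /negPf ->; rewrite mulr0.
Qed.

Let one : unit_ball R d -> R[i]^o := fun=> 1.

Lemma monomialX0 : monomialX mnm0 = one.
Proof.
by apply: funext => z; rewrite /monomialX /chi /truncate asboolT // monomial0 mul1r.
Qed.

Lemma opow_compressed_shift1 n : opow (compressed_shift X) n one = monomialX n.
Proof.
rewrite -monomialX0 -[in RHS](add0m n); apply: (@opow_translate _ _ _ monomialX) => j m.
exact: compressed_shift_monomialX.
Qed.

Lemma one_expansion : taylor_expansion one (fun m => (m == mnm0)%:R).
Proof.
apply: eq_taylor_expansion (@taylor_expansion_monomial R d mnm0) => // z.
by rewrite monomial0.
Qed.

Lemma Hd_one_norm : (Hd_norm one <= 1%:E)%E.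
Proof.
rewrite (Hd_normE one_expansion).
apply: (@weighted_norm_finsupp _ _ _ _ [:: mnm0]) => //.
- by move=> n; rewrite invr_ge0 ltW // beta_gt0.
- by move=> n; rewrite inE => /negPf ->.
rewrite big_seq1 eqxx beta0 invr1 mulr1 -[X in rnorm X]/((1 : R)%:C).
by rewrite rnorm_real.
Qed.

Lemma Hd_one (Y : set (multinom d)) : Y mnm0 -> Hd Y one.
Proof.
move=> Y0; split; first by rewrite (le_lt_trans Hd_one_norm) // ltry.
move=> n Yn; rewrite (taylorE one_expansion); case: eqP => // n0.
by rewrite n0 in Yn.
Qed.

Lemma multiplier_norm_ge0 phi : (0 <= multiplier_norm phi)%E.
Proof.
apply: (@le_trans _ _ (Hd_norm (mult_op phi one))); first exact: Hd_norm_ge0.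
apply: ereal_sup_ubound; exists one => //; split; first exact: Hd_one.
exact: Hd_one_norm.
Qed.

Lemma multiplier_expansion phi : multiplier phi ->
  taylor_expansion phi (taylor phi).
Proof.
move=> /(_ one (Hd_one I)) [phi1 _]; apply: Hd_norm_expansion.
by rewrite (_ : phi = mult_op phi one) //; apply: funext => z; rewrite /mult_op mulr1.
Qed.

Lemma sum_indicator (s : seq (multinom d)) (c : multinom d -> R[i]^o) m : uniq s ->
  \sum_(n <- s) c n * (m == n)%:R = if m \in s then c m else 0.
Proof.
move=> us; case: ifPn => ms.
  rewrite (bigD1_seq m) //= eqxx mulr1 big1 ?addr0 // => n.
  by rewrite eq_sym => /negPf ->; rewrite mulr0.
rewrite big_seq big1 // => n ns; case: eqP => [mn|]; last by rewrite mulr0.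
by rewrite mn ns in ms.
Qed.

Lemma monomialX_sum_expansion (s : seq (multinom d)) (c : multinom d -> R[i]^o) :
    uniq s ->
  exists2 b, taylor_expansion (fun z => \sum_(n <- s) c n * monomialX n z) b &
    forall m, X m -> b m = if m \in s then c m else 0.
Proof.
move=> us; exists (fun m => \sum_(n <- s) c n * (chi n * (m == n)%:R)).
  have Ve n := taylor_expansionZ (c := c n) (@monomialX_expansion n).
  exact: (taylor_expansion_sum (s := s) Ve).
move=> m Xm /=; rewrite -(sum_indicator _ _ us); apply: eq_bigr => n _.
have [mn|_] := eqVneq m n; last by rewrite !mulr0.
by rewrite -mn /chi /truncate asboolT // !mulr1.
Qed.

(** A single term of the norm series is bounded by the whole, so closeness in H_d controls each
    coefficient. *)
Lemma Hd_norm_coef f (e : R) m : 0 <= e -> (Hd_norm f < e%:E)%E ->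
  taylor_expansion f (taylor f) /\
  rnorm (taylor f m) <= e * Num.sqrt (beta R m).
Proof.
move=> e0 fe.
have fa : taylor_expansion f (taylor f).
  by apply: Hd_norm_expansion; rewrite (lt_trans fe) // ltry.
split=> //; move: fe; rewrite (Hd_normE fa) => /ltW.
move=> /(weighted_norm_leP _ _ e0) /(_ [:: m] isT); rewrite big_seq1.
rewrite ler_pdivrMr ?beta_gt0 // => h.
rewrite -ler_sqr ?nnegrE ?mulr_ge0 ?sqrtr_ge0 ?rnorm_ge0 //.
by rewrite exprMn sqr_sqrtr // ltW // beta_gt0.
Qed.

(* Both sides are read off from their action on the constant function 1. *)
Lemma calculus_coef phi (Q : mpoly d R[i]) m : multiplier phi ->
    compressed_calculus X phi (poly_op (compressed_shift X) Q) -> X m ->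
  taylor phi m = mcoeff m Q.
Proof.
move=> /multiplier_expansion phia [Sr [SrP Srlim]] Xm.
set c := taylor phi; set q := mcoeff m Q.
apply/eqP; rewrite -subr_eq0 -normr_eq0 -rnormE (inj_eq (@complexI R)).
rewrite eq_le rnorm_ge0 andbT.
pose b := Num.sqrt (beta R m).
(* The first term pays for replacing [c m] by [c m * r ^+ mdeg m]; each [b] turns an H_d error below
   [e] into an error in the [m]-th coefficient. *)
pose L := (mdeg m)%:R * rnorm (c m) + (b + b).
apply: (@ler_add_small _ _ _ L).
  by rewrite /L addr_ge0 ?addr_ge0 ?mulr_ge0 ?rnorm_ge0 ?sqrtr_ge0.
move=> e /andP[e0 e1]; rewrite add0r.
have oneX : Hd X one := Hd_one X0.
have e0' : (0 < e%:E)%E by rewrite lte_fin.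
have [r [[rlim er] r1]] : exists r : R,
    ((Hd_norm (Sr r one - poly_op (compressed_shift X) Q one)%R < e%:E)%E /\
     1 - e < r) /\ r < 1.
  apply: (@filter_ex _ (1 : R)^'-); apply: filterI; last exact: withinT.
  apply: filterI; last by apply: nbhs_left_gt; rewrite gtrBl.
  exact: (Srlim one oneX _ (open_ereal_lt' e0')).
have r0 : 0 <= r by rewrite ltW // (le_lt_trans _ er) // subr_ge0.
have re : 1 - r <= e by rewrite lerBlDl -lerBlDr ltW.
(* Forcing [m] into [J] makes the [m]-th coefficient of the partial sum equal to that of the full
   series. *)
have [J [mJ Jlim]] : exists J : {fset multinom d}, m \in J /\
  (Hd_norm (summability.partial_sum (fun n => (c n * (r ^+ mdeg n)%:C) *:
     opow (compressed_shift X) n one) J - Sr r one)%R < e%:E)%E.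
  have r01 : 0 <= r < 1 by rewrite r0.
  have [J0 _ J0P] := SrP r r01 _ (open_ereal_lt' e0').
  exists (fsetU J0 (fset1 m)); split; first by rewrite !inE eqxx orbT.
  have := J0P (fsetU J0 (fset1 m)) (fsubsetUl _ _); apply: le_lt_trans.
  by apply: ereal_sup_ubound; exists one => //; split=> //; exact: Hd_one_norm.
pose c' n : R[i]^o := c n * (r ^+ mdeg n)%:C.
have [t1 t1m] := Hd_norm_coef m (ltW e0) Jlim.
have [t2 t2m] := Hd_norm_coef m (ltW e0) rlim.
have [b1 b1e b1m] := monomialX_sum_expansion c' (fset_uniq J).
have [b2 b2e b2m] := monomialX_sum_expansion (fun n => mcoeff n Q) (msupp_uniq Q).
have t3 := taylor_expansionD b1e (taylor_expansionZ (c := -1) b2e).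
have p1 : summability.partial_sum (fun n => (c n * (r ^+ mdeg n)%:C) *:
    opow (compressed_shift X) n one) J = fun z => \sum_(n <- J) c' n * monomialX n z.
  apply: funext => z; rewrite partial_sumE fct_sumE; apply: eq_bigr => n _.
  by rewrite opow_compressed_shift1.
have p2 : poly_op (compressed_shift X) Q one =
    fun z => \sum_(n <- msupp Q) mcoeff n Q * monomialX n z.
  apply: funext => z; rewrite /poly_op fct_sumE; apply: eq_bigr => n _.
  by rewrite opow_compressed_shift1.
have t4 := taylor_expansionD t1 t2.
(* [taylor] is a choice of expansion, so its additivity is derived from uniqueness, applied to
   partial sum minus Q(M_z^X) 1 split at [Sr r one]. *)
have E : c m * (r ^+ mdeg m)%:C - q = taylor (summability.partial_sum (fun n =>
    (c n * (r ^+ mdeg n)%:C) *: opow (compressed_shift X) n one) J - Sr r one) m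
    + taylor (Sr r one - poly_op (compressed_shift X) Q one) m.
  rewrite -(congr1 (@^~ m) (taylor_expansion_unique t3 (eq_taylor_expansion _
    (fun=> erefl) t4))); last first.
    move=> z; rewrite p1 p2 mulN1r.
    have split3 (u v w : R[i]^o) : u - w = (u - v) + (v - w).
      by rewrite addrA subrK.
    rewrite !addrfctE !opprfctE; exact: split3.
  rewrite b1m // b2m // mJ mulN1r; congr (_ - _).
  by rewrite /q; case: ifPn => // /memN_msupp_eq0.
have -> : c m - q = (1 - r ^+ mdeg m)%:C * c m + (c m * (r ^+ mdeg m)%:C - q).
  by rewrite rmorphB rmorph1; ring.
rewrite /L mulrDr; apply: le_trans (rnormD _ _) _; apply: lerD.
  have rm : r ^+ mdeg m <= 1 by rewrite exprn_ile1 // ltW.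
  rewrite rnormM rnorm_real ?subr_ge0 // mulrA ler_wpM2r ?rnorm_ge0 //.
  apply: le_trans (bernoulli_one_minus _ _) _; first by rewrite r0 ltW.
  by rewrite mulrC ler_wpM2r.
rewrite E mulrDr; apply: le_trans (rnormD _ _) _; exact: lerD t1m t2m.
Qed.

Lemma multiplier_bound phi (Q : mpoly d R[i]) : multiplier phi ->
    compressed_calculus X phi (poly_op (compressed_shift X) Q) ->
  (opnorm (l2 X) (@l2norm R d) (poly_op (compressed_backward_shift X) Q)
     <= multiplier_norm phi)%E.
Proof.
move=> mphi calc.
have phia := multiplier_expansion mphi.
have coefE m : X m -> taylor phi m = mcoeff m Q.
  by move=> Xm; apply: calculus_coef.
have := multiplier_norm_ge0 phi.
case CE : (multiplier_norm phi) => [c| |] // c0; last by rewrite leey.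
rewrite lee_fin in c0.
apply: ge_ereal_sup => _ [g [[_ gX] g1] <-].
apply/weighted_norm_leP => // s us.
pose G n : R[i]^o := \sum_(k <- msupp Q) mcoeff k Q * g (mnm_add n k).
rewrite (eq_bigr (fun n => rnorm (G n) ^+ 2 * beta R n)); last first.
  by move=> n _; rewrite poly_op_backward_shift.
set S := \sum_(n <- s) _.
have S0 : 0 <= S.
  by apply: sumr_ge0 => n _; rewrite mulr_ge0 ?sqr_ge0 // ltW // beta_gt0.
have [->|S_neq0] := eqVneq S 0; first exact: sqr_ge0.
pose t := Num.sqrt S.
have t0 : 0 < t by rewrite sqrtr_gt0 lt_def S_neq0.
have tS : t ^+ 2 = S by rewrite sqr_sqrtr.
rewrite -tS ler_sqr ?nnegrE ?(ltW t0) //.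
(* f is the unit vector dual to the restriction of G to s. *)
pose fc n : R[i]^o := if n \in s then (beta R n / t)%:C * (G n)^* else 0.
have fc_norm n : n \in s -> rnorm (fc n) ^+ 2 / beta R n =
    rnorm (G n) ^+ 2 * beta R n / S.
  move=> ns; rewrite /fc ns rnormM rnorm_real; last first.
    by rewrite divr_ge0 ?ltW // beta_gt0.
  have -> : rnorm ((G n)^* : R[i]^o) = rnorm (G n).
    by apply: complexI; rewrite !rnormE; exact: norm_conjC.
  have b0 : beta R n != 0 by rewrite gt_eqF ?beta_gt0.
  by rewrite -tS; field; rewrite b0 gt_eqF.
have fcs n : n \notin s -> fc n = 0 by rewrite /fc => /negPf ->.
pose f z := \sum_(n <- s) fc n * @monomial R d n z.
have fe : taylor_expansion f fc by apply: taylor_expansion_finsupp.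
have f1 : (Hd_norm f <= 1%:E)%E.
  rewrite (Hd_normE fe); apply: (@weighted_norm_finsupp _ _ _ _ s) => //.
    by move=> n; rewrite invr_ge0 ltW // beta_gt0.
  rewrite big_seq (eq_bigr _ fc_norm) -big_seq -mulr_suml divff //.
  by rewrite expr1n.
have fHd : Hd setT f.
  by split=> [|n []//]; rewrite (le_lt_trans f1) // ltry.
pose bm m : R[i]^o := \sum_(n <- s)
  fc n * (if mpoly.lem n m then taylor phi (mnm_sub m n) else 0).
have be : taylor_expansion (mult_op phi f) bm.
  have bei n := taylor_expansionZ (c := fc n)
    (@taylor_expansion_shift _ _ phi (taylor phi) n phia).
  apply: eq_taylor_expansion (taylor_expansion_sum (s := s) bei) => // z.
  by rewrite /mult_op /f mulr_sumr; apply: eq_bigr => n _; ring.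
have bc : (Hd_norm (mult_op phi f) <= c%:E)%E.
  by rewrite -CE; apply: ereal_sup_ubound; exists f.
(* These indices carry the whole pairing of [g] with phi f: elsewhere the relevant coefficients of
   [Q] are 0 or [g] vanishes. *)
pose E := undup [seq mnm_add n k | n <- s, k <- msupp Q].
(* The duality identity. If m is in [X], its divisor m - n is too, and there phi has the
   coefficients of [Q]; if m is not in [X], then [g m = 0]. The other side is the sum of the
   [fc n * G n], equal to S / t = t. *)
have tE : (t%:C : R[i]^o) = \sum_(m <- E) g m * bm m.
  under eq_bigr => m _ do rewrite /bm mulr_sumr.
  rewrite exchange_big /= big_seq (eq_bigr (fun n => fc n * G n)); last first.
    move=> n ns; rewrite /G mulr_sumr.
    transitivity (\sum_(m <- [seq mnm_add n k | k <- msupp Q])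
        fc n * (mcoeff (mnm_sub m n) Q * g m)); last first.
      rewrite big_map; apply: eq_bigr => k _.
      by rewrite [mnm_add n k]addmC addmK.
    transitivity (\sum_(m <- [seq m <- E | mpoly.lem n m && (mnm_sub m n \in msupp Q)])
        fc n * (mcoeff (mnm_sub m n) Q * g m)).
      rewrite big_filter [RHS]big_mkcond /=; apply: eq_bigr => m _.
      case: ifPn => [nm|] /=; last by rewrite !mulr0.
      have -> : g m * (fc n * taylor phi (mnm_sub m n)) =
          fc n * (mcoeff (mnm_sub m n) Q * g m).
        have [Xm|/gX ->] := pselect (X m); last by rewrite mul0r !mulr0.
        rewrite coefE; first ring.
        by apply: (@Xdown _ n); rewrite submK.
      by case: ifPn => // /memN_msupp_eq0 ->; rewrite mul0r mulr0.
    apply: perm_big; apply: uniq_perm.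
    - by rewrite filter_uniq ?undup_uniq.
    - by rewrite map_inj_uniq ?msupp_uniq //; exact: addmI.
    move=> m; rewrite mem_filter mem_undup; apply/idP/mapP.
      move=> /andP[/andP[nm mQ] _]; exists (mnm_sub m n) => //.
      by rewrite addmC submK.
    move=> [k kQ ->]; rewrite lem_addr addmC addmK kQ /=.
    by apply/allpairsP; exists (n, k); rewrite /= addmC.
  rewrite -big_seq.
  have -> : t = S / t by rewrite -tS expr2 mulfK // gt_eqF.
  rewrite /S mulr_suml rmorph_sum /= !big_seq; apply: eq_bigr => n ns.
  rewrite /fc ns -[rnorm (G n) ^+ 2 * beta R n / t]mulrA rmorphM rmorphXn /= rnormE.
  by rewrite normCK; ring.
apply/ler_addgt0Pr => e e0; pose c1 := c + e.
have c10 : 0 < c1 by rewrite ltr_wpDl.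
have le_sum (a : multinom d -> R[i]^o) w c2 : (weighted_norm w a <= c2%:E)%E ->
    0 <= c2 -> \sum_(m <- E) rnorm (a m) ^+ 2 * w m <= c2 ^+ 2.
  by move=> + c20 => /(weighted_norm_leP _ _ c20); apply; exact: undup_uniq.
have gS := le_sum _ _ _ g1 ler01.
move: bc; rewrite (Hd_normE be) => bc; have bS := le_sum _ _ _ bc c0.
rewrite -/c1 -(rnorm_real (ltW t0)) tE; apply: le_trans (rnorm_sum _ _ _) _.
(* AM-GM with weight c1, which is positive even if c = 0. *)
apply: (@le_trans _ _ (\sum_(m <- E) (c1 / 2 * (rnorm (g m) ^+ 2 * beta R m) +
    (2 * c1)^-1 * (rnorm (bm m) ^+ 2 * (beta R m)^-1)))).
  apply: ler_sum => m _; rewrite rnormM -subr_ge0.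
  have b0 := beta_gt0 R m.
  have -> : c1 / 2 * (rnorm (g m) ^+ 2 * beta R m) +
    (2 * c1)^-1 * (rnorm (bm m) ^+ 2 * (beta R m)^-1) - rnorm (g m) * rnorm (bm m)
    = (2 * c1 * beta R m)^-1 * (c1 * beta R m * rnorm (g m) - rnorm (bm m)) ^+ 2.
    by field; rewrite !gt_eqF.
  by rewrite mulr_ge0 ?sqr_ge0 // invr_ge0 ltW // mulr_gt0 // mulr_gt0.
rewrite big_split /= -!mulr_sumr.
apply: (@le_trans _ _ (c1 / 2 * 1 + (2 * c1)^-1 * c1 ^+ 2)).
  have c2 : 0 <= c1 / 2 by rewrite divr_ge0 // ltW.
  have c3 : 0 <= (2 * c1)^-1 by rewrite invr_ge0 mulr_ge0 // ltW.
  apply: lerD; [apply: ler_wpM2l => //|apply: ler_wpM2l => //].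
    by apply: le_trans gS _; rewrite expr1n.
  apply: le_trans bS _; rewrite ler_sqr ?nnegrE ?(ltW c10) //.
  by rewrite /c1 lerDl ltW.
rewrite le_eqVlt; apply/orP; left; apply/eqP; field.
by rewrite gt_eqF.
Qed.

End Multipliers.

Theorem theorem4p1 (R : realType) (d : nat) (d_ge2 : (2 <= d)%N)
  (H : completeNormedModType R[i]) (ip : {dot H for Num.conj})
  (norm_ip : forall h : H, `|h| ^+ 2 = ip h h)
  (A : 'I_d -> {linear H -> H})
  (A_bounded : forall j, continuous (A j))
  (A_comm : forall i j h, A i (A j h) = A j (A i h))
  (A_contr : forall h, \sum_(j < d) `|A j h| ^+ 2 <= `|h| ^+ 2)
  (X : set (multinom d))
  (X_def : X = ~` [set n | forall h, opow (fun j => A j) n h = 0])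
  (Q : mpoly d R[i]) :
  (opnorm setT (fun h => (rnorm h)%:E) (poly_op (fun j => A j) Q)
     <= opnorm (l2 X) (@l2norm R d) (poly_op (compressed_backward_shift X) Q))%E
  /\
  (opnorm (l2 X) (@l2norm R d) (poly_op (compressed_backward_shift X) Q)
     <= ereal_inf [set multiplier_norm phi | phi in [set phi | multiplier phi /\
          compressed_calculus X phi (poly_op (compressed_shift X) Q)]])%E.
Proof.
have Xdown := nonvanishing_down A_comm X_def.
split; first exact: (von_neumann norm_ip A_comm A_contr X_def).
apply: le_ereal_inf_tmp => _ [phi [mphi calc] <-].
(* The constant 1 lies in H_d(X) only if 0 is in [X]. Otherwise [X] is empty, being closed under
   divisors, and l^2(X, beta) is zero. *)
have [X0|X0] := pselect (X mnm0); first exact: (multiplier_bound Xdown X0).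
have Xempty n : ~ X n by move=> Xn; apply: X0; apply: (Xdown _ n); rewrite add0m.
apply: ge_ereal_sup => _ [g [[_ gX] _] <-].
apply: le_trans (multiplier_norm_ge0 phi).
apply/weighted_norm_leP => // s _; rewrite expr0n big1 // => n _.
rewrite poly_op_backward_shift // big1 ?rnorm0 ?expr0n ?mul0r // => k _.
by rewrite gX ?mulr0.
Qed.
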